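(* Let $K\subset\mathbb{R}^d$ be a measurable set with non-empty interior, let $\rho\colon K\to[0,\infty)$ be Lebesgue-integrable with $\int_K\rho(x)\,\mathrm{d}x>0$, and let $\pi$ be the probability measure on $K$ given by $\pi(A)=\int_A\rho(x)\,\mathrm{d}x\big/\int_K\rho(x)\,\mathrm{d}x$. Let $e_1,\dots,e_d$ be the standard basis of $\mathbb{R}^d$. Then the Markov operator $G$ of the random scan Gibbs sampler, defined for $f\in L_2(\pi)$ by $$Gf(x)=\frac1d\sum_{j=1}^d\frac{1}{\ell(x,e_j)}\int_{L(x,e_j)}f(y)\,\rho(y)\,\mathrm{d}y ,$$ is a positive operator on $L_2(\pi)$.
   Context: $L_2(\pi)$ is the real Hilbert space of ($\pi$-a.e. equivalence classes of) $\pi$-square-integrable functions $f\colon K\to\mathbb{R}$ with inner product $\langle f,g\rangle=\int_K f(x)g(x)\,\mathrm{d}\pi(x)$. A self-adjoint operator $P$ on $L_2(\pi)$ is called positive if $\langle Pf,f\rangle\ge 0$ for all $f\in L_2(\pi)$. For $x\in K$ and a unit vector $\theta\in\mathbb{R}^d$, the chord through $x$ in direction $\theta$ is $L(x,\theta)=\{x+s\theta\in K\mid s\in\mathbb{R}\}$, and its total weight is $\ell(x,\theta)=\int_{L(x,\theta)}\rho(y)\,\mathrm{d}y$, where integrals over $L(x,\theta)$ are with respect to one-dimensional Lebesgue measure on the line. For $\pi$-a.e. $x$ and every $j$ one has $0<\ell(x,e_j)<\infty$, and $Gf$ is understood as defined $\pi$-almost everywhere. *)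

(* Defs.v *)
From HB Require Import structures.
From mathcomp Require Import all_boot all_order all_algebra.
From mathcomp Require Import all_classical all_reals all_analysis.

Set Implicit Arguments.
Unset Strict Implicit.
Unset Printing Implicit Defensive.
Import Order.TTheory GRing.Theory Num.Theory.
Import numFieldNormedType.Exports.

Local Open Scope classical_set_scope.
Local Open Scope ring_scope.

(* Lebesgue measure on R^n, for which the library only has n = 1, is obtained
   in three steps: the Borel sigma-algebra on row vectors, the n-fold product
   of one-dimensional Lebesgue measure on it, and its completion. *)

Section borel_space.
Variables (R : realType) (n : nat).

(* R^n with the sigma-algebra generated by the coordinate functions, that is,
   its Borel sigma-algebra. *)
Definition borel_rV : Type := 'rV[R]_n.

Definition rV_coord (i : 'I_n) (v : borel_rV) : measurableTypeR R :=
  (v : 'rV[R]_n) ord0 i.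

Definition borel_rV_display : measure_display.
Proof. exact: default_measure_display. Qed.

HB.instance Definition _ := Pointed.on borel_rV.

Let borel_rV0 : g_sigma_preimage rV_coord set0.
Proof. exact: sigma_algebra0. Qed.

Let borel_rVC A : g_sigma_preimage rV_coord A ->
  g_sigma_preimage rV_coord (~` A).
Proof. exact: sigma_algebraC. Qed.

Let borel_rV_bigcup (F : (set borel_rV)^nat) :
  (forall i, g_sigma_preimage rV_coord (F i)) ->
  g_sigma_preimage rV_coord (\bigcup_i (F i)).
Proof. exact: sigma_algebra_bigcup. Qed.

HB.instance Definition _ := @isMeasurable.Build borel_rV_display borel_rV
  (g_sigma_preimage rV_coord) borel_rV0 borel_rVC borel_rV_bigcup.

Lemma measurable_rV_coord i : measurable_fun [set: borel_rV] (rV_coord i).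
Proof.
move=> _ Y mY; rewrite setTI; apply: sub_sigma_algebra => /=.
rewrite -bigcup_seq/=; exists i => /=; first by rewrite mem_index_enum.
by exists Y => //; rewrite setTI.
Qed.

Lemma measurable_fun_rV d (T : measurableType d) (f : T -> borel_rV) :
  (forall i, measurable_fun [set: T] (rV_coord i \o f)) ->
  measurable_fun [set: T] f.
Proof.
move=> mf; apply: (@measurability _ _ _ _ _ _
  (\big[setU/set0]_(i < n) preimage_set_system setT (rV_coord i) measurable)).
  by [].
move=> _ [B + <-]; rewrite -bigcup_seq/= => -[i _ [A mA <-]].
by rewrite !setTI -comp_preimage -[X in measurable X]setTI; exact: mf.
Qed.

End borel_space.

Section rV_cons.
Variables (R : realType) (n : nat).

Definition rV_cons (p : measurableTypeR R * borel_rV R n) : borel_rV R n.+1 :=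
  row_mx (p.1 : R)%:M (p.2 : 'rV[R]_n).

Definition rV_uncons (v : borel_rV R n.+1) : measurableTypeR R * borel_rV R n :=
  (rV_coord ord0 v, \row_j rV_coord (lift ord0 j) v).

Lemma rV_cons0 x v : rV_coord ord0 (rV_cons (x, v)) = x.
Proof.
rewrite /rV_coord /rV_cons/=.
have -> : (ord0 : 'I_n.+1) = lshift n (ord0 : 'I_1) by exact/val_inj.
by rewrite (@row_mxEl R 1 1 n) mxE eqxx mulr1n.
Qed.

Lemma rV_consS x v j : rV_coord (lift ord0 j) (rV_cons (x, v)) = rV_coord j v.
Proof.
rewrite /rV_coord /rV_cons/=.
have -> : lift (ord0 : 'I_n.+1) j = rshift 1 j by exact/val_inj.
by rewrite (@row_mxEr R 1 1 n).
Qed.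

Lemma rV_consK : cancel rV_cons rV_uncons.
Proof.
move=> [x v]; rewrite /rV_uncons rV_cons0; congr pair.
by apply/rowP => j; rewrite mxE rV_consS.
Qed.

Lemma measurable_rV_cons : measurable_fun setT rV_cons.
Proof.
apply: measurable_fun_rV => i; have [j ->|->] := unliftP ord0 i.
- rewrite (_ : _ \o _ = rV_coord j \o snd).
    apply: measurableT_comp; [exact: measurable_rV_coord|exact: measurable_snd].
  by apply/funext => -[x v]; exact: rV_consS.
- rewrite (_ : _ \o _ = fst); first exact: measurable_fst.
  by apply/funext => -[x v]; exact: rV_cons0.
Qed.

Lemma measurable_rV_uncons : measurable_fun setT rV_uncons.
Proof.
apply/measurable_fun_pairP; split; first exact: measurable_rV_coord.
apply: measurable_fun_rV => i.
rewrite (_ : _ \o _ = rV_coord (lift ord0 i)); first exact: measurable_rV_coord.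
by apply/funext => v; rewrite /= /rV_coord mxE.
Qed.

End rV_cons.

Section lebesgue_succ.
Local Open Scope ereal_scope.
Variables (R : realType) (n : nat).
Variable m : {sigma_finite_measure set (borel_rV R n) -> \bar R}.

Definition lebesgue_succ : set (borel_rV R n.+1) -> \bar R :=
  pushforward (@lebesgue_measure R \x m) (@rV_cons R n).

Let lebesgue_succ0 : lebesgue_succ set0 = 0.
Proof. by rewrite /lebesgue_succ /pushforward preimage_set0 measure0. Qed.

Let lebesgue_succ_ge0 A : 0 <= lebesgue_succ A.
Proof. by rewrite /lebesgue_succ /pushforward; exact: measure_ge0. Qed.

Let lebesgue_succ_sigma_additive : semi_sigma_additive lebesgue_succ.
Proof.
have mK A : measurable A -> measurable (@rV_cons R n @^-1` A).
  by move=> mA; rewrite -[X in measurable X]setTI; exact: measurable_rV_cons.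
move=> F mF tF mUF; rewrite /lebesgue_succ /pushforward preimage_bigcup.
apply: measure_semi_sigma_additive.
- by move=> k; exact: mK.
- apply/trivIsetP => /= i j _ _ ij; rewrite -preimage_setI.
  by move/trivIsetP : tF => /(_ _ _ _ _ ij) ->//; rewrite preimage_set0.
- by rewrite -preimage_bigcup; exact: mK.
Qed.

HB.instance Definition _ := isMeasure.Build _ _ _ lebesgue_succ
  lebesgue_succ0 lebesgue_succ_ge0 lebesgue_succ_sigma_additive.

Let lebesgue_succ_sigma_finite : sigma_finite setT lebesgue_succ.
Proof.
have /sigma_finiteP[F [FT ndF Foo]] := sigma_finiteT (@lebesgue_measure R).
have /sigma_finiteP[G [GT ndG Goo]] := sigma_finiteT m.
have mFG k : measurable (F k `*` G k).
  by apply: measurableX; [case: (Foo k)|case: (Goo k)].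
exists (fun k => @rV_uncons R n @^-1` (F k `*` G k)).
  apply/seteqP; split => // v _.
  have [k _ Fk] : (\bigcup_k F k) (rV_uncons v).1 by rewrite -FT.
  have [l _ Gl] : (\bigcup_k G k) (rV_uncons v).2 by rewrite -GT.
  exists (maxn k l) => //; split.
  - by move: Fk; exact/subsetPset/ndF/leq_maxl.
  - by move: Gl; exact/subsetPset/ndG/leq_maxr.
move=> k; have [mF Fk] := Foo k; have [mG Gk] := Goo k; split.
  by rewrite -[X in measurable X]setTI; exact: measurable_rV_uncons.
rewrite /lebesgue_succ /pushforward -comp_preimage.
rewrite (_ : _ \o _ = id); last by apply/funext => p /=; rewrite rV_consK.
by rewrite product_measure1E// lte_mul_pinfty// ge0_fin_numE.
Qed.

HB.instance Definition _ := @Measure_isSigmaFinite.Build _ _ _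
  lebesgue_succ lebesgue_succ_sigma_finite.

End lebesgue_succ.

Section lebesgue_rV.
Variable R : realType.

Fixpoint lebesgue_borel_rV n :
    {sigma_finite_measure set (borel_rV R n) -> \bar R} :=
  match n with
  | 0 => [the {sigma_finite_measure set (borel_rV R 0) -> \bar R} of
           dirac ((0 : 'rV[R]_0) : borel_rV R 0)]
  | n'.+1 => [the {sigma_finite_measure set (borel_rV R n'.+1) -> \bar R} of
           lebesgue_succ (lebesgue_borel_rV n')]
  end.

(* R^n with the sigma-algebra of Lebesgue (not only Borel) measurable sets;
   the carrier is convertible to 'rV[R]_n. *)
Definition lebesgue_space n :
    measurableType (caratheodory_display (mu_ext (lebesgue_borel_rV n))) :=
  caratheodory_type (mu_ext (lebesgue_borel_rV n)).

Definition lebesgue_rV n : set (lebesgue_space n) -> \bar R :=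
  @completed_measure_extension _ _ _ (lebesgue_borel_rV n).

HB.instance Definition _ n := Measure.on (@lebesgue_rV n).

Let lebesgue_rV_sigma_finite n : sigma_finite setT (@lebesgue_rV n).
Proof. exact/completed_measure_extension_sigma_finite/sigma_finiteT. Qed.

HB.instance Definition _ n := @Measure_isSigmaFinite.Build _ _ _
  (@lebesgue_rV n) (@lebesgue_rV_sigma_finite n).

End lebesgue_rV.

Section L2_operators.
Context d (T : measurableType d) (R : realType).
Variable pi : {measure set T -> \bar R}.

Definition L2_inner (f g : T -> R) : R := \int[pi]_x (f x * g x).

(* An operator on the space L_2(pi) of classes modulo a.e. equality is given by
   its action P on representatives; the first two fields say that P descends to
   a map of L_2(pi) into itself. *)
Record bounded_L2_operator (P : (T -> R) -> T -> R) : Prop := {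
  L2_op_closed : forall f, f \in Lfun pi 2%:E -> P f \in Lfun pi 2%:E ;
  L2_op_ae : forall f g, f \in Lfun pi 2%:E -> g \in Lfun pi 2%:E ->
    f = g %[ae pi] -> P f = P g %[ae pi] ;
  L2_op_linear : forall (a : R) f g,
    f \in Lfun pi 2%:E -> g \in Lfun pi 2%:E ->
    P (fun x => a * f x + g x) = (fun x => a * P f x + P g x) %[ae pi] ;
  L2_op_bounded : exists C : R, forall f, f \in Lfun pi 2%:E ->
    L2_inner (P f) (P f) <= C * L2_inner f f }.

Definition self_adjoint (P : (T -> R) -> T -> R) : Prop :=
  forall f g, f \in Lfun pi 2%:E -> g \in Lfun pi 2%:E ->
    L2_inner (P f) g = L2_inner f (P g).

Definition positive_operator (P : (T -> R) -> T -> R) : Prop :=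
  [/\ bounded_L2_operator P, self_adjoint P &
      forall f, f \in Lfun pi 2%:E -> 0 <= L2_inner (P f) f].

End L2_operators.

Section gibbs_sampler.
Variables (R : realType) (d : nat).
Implicit Types (K : set 'rV[R]_d) (x theta : 'rV[R]_d).

Definition chord K x theta : set 'rV[R]_d :=
  [set y | K y /\ exists s : R, y = x + s *: theta].

(* Integral over the chord with respect to one-dimensional Lebesgue measure on
   the line; s |-> x + s *: theta is an arc length parametrization because
   theta is meant to be a unit vector. *)
Definition chord_integral K x theta (g : 'rV[R]_d -> R) : R :=
  \int[@completed_lebesgue_measure R]_(s in
    [set s : R | chord K x theta (x + (s : R) *: theta)])
    g (x + (s : R) *: theta).

Definition chord_weight K (rho : 'rV[R]_d -> R) x theta : R :=
  chord_integral K x theta rho.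

Definition std_basis (j : 'I_d) : 'rV[R]_d := delta_mx ord0 j.

(* A function on K is represented by a total function on R^d whose values
   outside K are irrelevant: chords lie in K and pi is carried by K.
   Where the weight is 0 or infinite, or the integral of f * rho diverges, the
   conventions fine +oo = 0 and 0^-1 = 0 give a junk value; Gf is only
   meaningful pi-almost everywhere. *)
Definition gibbs K (rho f : 'rV[R]_d -> R) x : R :=
  d%:R^-1 * \sum_(j < d)
    (chord_weight K rho x (std_basis j))^-1 *
    chord_integral K x (std_basis j) (fun y => f y * rho y).

End gibbs_sampler.

(* Main.v *)
(* The operator is the average over j of the operators E_j that replace f by
   its rho-weighted mean over the chord in direction e_j. A mean over chords is
   constant along them, so E_j is idempotent; it is symmetric for pi because
   by Tonelli and translation invariance of Lebesgue measure the line integral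
   operator T F x = \int F (x + s e_j) ds is symmetric on nonnegative Borel
   functions. Hence <E_j f, f> = <E_j f, E_j f> >= 0.
   Lebesgue measurable data are reduced to Borel ones by modification on a null
   set, which almost every chord meets in a set of length zero. *)

Require Import Defs.
From mathcomp Require Import all_boot all_order all_algebra.
From mathcomp Require Import all_classical all_reals all_analysis.
From mathcomp Require Import measurable_realfun lra ring.

Set Implicit Arguments.
Unset Strict Implicit.
Unset Printing Implicit Defensive.
Import Order.TTheory GRing.Theory Num.Theory.
Import numFieldNormedType.Exports.

Local Open Scope classical_set_scope.
Local Open Scope ring_scope.

(** Tonelli concerns product sigma-algebras, and the completed n-dimensional measure is not a
    product: a Lebesgue measurable function can have non-measurable restrictions to exceptional
    lines. This forces the Borel detour for [K], [rho] and the arguments of the operator alike. On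
    the Borel side symmetry is proved for nonnegative functions with values in the extended reals,
    where no integral has to converge. The real mean of a nonnegative function coincides with the
    extended one where the latter is finite. That this happens almost everywhere, and that the
    operator maps L_2 into itself, follows from one estimate: symmetry tested against the constant
    1, whose mean is at most 1, gives a contraction of L_1, and Jensen's inequality lifts it to L_2.
    Signed functions come last, split into positive and negative parts. Classes in L_2(pi) leave a
    function arbitrary where the density vanishes, whereas the argument on lines needs Lebesgue null
    sets. The gap closes because a function enters its mean only through its product with [rho]. *)

(** * Change of variables along measure-preserving maps *)

Section measure_preserving.
Local Open Scope ereal_scope.
Context d1 d2 (T1 : measurableType d1) (T2 : measurableType d2) (R : realType).
Variables (mu1 : {measure set T1 -> \bar R}) (mu2 : {measure set T2 -> \bar R}).
Variable phi : T1 -> T2.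
Hypothesis mphi : measurable_fun setT phi.
Hypothesis muphi : forall A, measurable A -> mu1 (phi @^-1` A) = mu2 A.

Lemma ge0_integral_measure_preserving (f : T2 -> \bar R) :
  measurable_fun setT f -> (forall x, 0 <= f x) ->
  \int[mu1]_x f (phi x) = \int[mu2]_x f x.
Proof.
move=> mf f0.
have := @ge0_integral_pushforward _ _ _ _ _ _ mphi mu1 setT f measurableT mf.
rewrite preimage_setT => <-//.
by apply: eq_measure_integral => A mA _; exact: muphi.
Qed.

(** The integral is a difference of integrals of the positive and negative parts, and each part is
    transported separately. *)
Lemma integral_measure_preserving (f : T2 -> \bar R) : measurable_fun setT f ->
  \int[mu1]_x f (phi x) = \int[mu2]_x f x.
Proof.
move=> mf; rewrite integralE [RHS]integralE.
congr (_ - _).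
- rewrite -(ge0_integral_measure_preserving
    (measurable_funepos mf) (funepos_ge0 _)).
  by apply: eq_integral => x _; rewrite !funeposE.
- rewrite -(ge0_integral_measure_preserving
    (measurable_funeneg mf) (funeneg_ge0 _)).
  by apply: eq_integral => x _; rewrite !funenegE.
Qed.

Lemma ae_measure_preserving (P : T2 -> Prop) :
  (\forall x \ae mu2, P x) -> \forall x \ae mu1, P (phi x).
Proof.
move=> [N [mN N0 PN]]; exists (phi @^-1` N); split.
- by rewrite -[X in measurable X]setTI; exact: mphi.
- by rewrite -N0; exact: muphi.
- by move=> x; exact: PN.
Qed.

Hypothesis mu1_complete : measure_is_complete mu1.

(** Meant for [phi] the identity from a completed space to its Borel version: completeness makes
    everything that agrees almost everywhere with a Borel function measurable. *)
Lemma complete_ae_measurable (f : T1 -> \bar R) (g : T2 -> \bar R) :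
  measurable_fun setT g -> (\forall x \ae mu1, f x = g (phi x)) ->
  measurable_fun setT f.
Proof.
move=> mg fg; apply: (@ae_measurable_fun _ _ _ mu1 mu1_complete _ (g \o phi)).
- by apply: filterS fg => x ->.
- exact: measurableT_comp.
Qed.

Lemma complete_ae_integral (f : T1 -> \bar R) (g : T2 -> \bar R) :
  measurable_fun setT g -> (\forall x \ae mu1, f x = g (phi x)) ->
  \int[mu1]_x f x = \int[mu2]_x g x.
Proof.
move=> mg fg; rewrite -integral_measure_preserving//.
apply: ae_eq_integral => //; first exact: complete_ae_measurable fg.
- exact: measurableT_comp.
- by apply: filterS fg.
Qed.

End measure_preserving.

(** * Translation and reflection on the real line *)

Section lebesgue_symmetries.
Local Open Scope ereal_scope.
Context (R : realType).
Local Notation lambda := (@lebesgue_measure R).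

(** The pushforward under a translation gives each half-open interval its length, which
    characterizes Lebesgue measure. *)
Lemma lebesgue_measure_preimageD (c : R) (A : set (measurableTypeR R)) :
  measurable A ->
  lambda ((fun x : measurableTypeR R => (x : R) + c)%R @^-1` A) = lambda A.
Proof.
move=> mA; rewrite [RHS](@lebesgue_measure_unique R
  [the {measure set (measurableTypeR R) -> \bar R} of
    pushforward lambda
      (fun x : measurableTypeR R => (x : R) + c : measurableTypeR R)%R])//.
  exact: measurable_funD.
move=> mphi _ [[a b] _ <-] /=.
rewrite /pushforward.
have -> : (fun x : measurableTypeR R => (x : R) + c)%R @^-1` [set` `]a, b]] =
    [set` `](a - c), (b - c)]]%R.
  by apply/seteqP; split => x /=; rewrite !in_itv/= ltrBlDr lerBrDr.
rewrite !lebesgue_measure_itv/= !lte_fin ltrD2r; case: ifPn => // _.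
by rewrite -!EFinB; congr EFin; ring.
Qed.

Lemma ge0_integral_lebesgueD (f : R -> \bar R) (c : R) :
  measurable_fun [set: measurableTypeR R] f -> (forall x, 0 <= f x) ->
  \int[lambda]_x f (x + c)%R = \int[lambda]_x f x.
Proof.
move=> mf f0; apply: (@ge0_integral_measure_preserving _ _ _ _ _ lambda lambda
  (fun x : measurableTypeR R => x + c)%R _ _ f) => //.
- exact: measurable_funD.
- by move=> A mA; exact: lebesgue_measure_preimageD.
Qed.

Lemma ge0_integral_lebesgueN (f : R -> \bar R) :
  measurable_fun [set: measurableTypeR R] f -> (forall x, 0 <= f x) ->
  \int[lambda]_x f (- x)%R = \int[lambda]_x f x.
Proof.
move=> mf f0; apply: (@ge0_integral_measure_preserving _ _ _ _ _ lambda lambda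
  (fun x : measurableTypeR R => - (x : R))%R _ _ f) => //.
  exact: oppr_measurable.
exact: lebesgue_measureN.
Qed.

End lebesgue_symmetries.

(** * Translation invariance in dimension n *)

Lemma rV_consD (R : realType) n (t : R) (v : 'rV[R]_n) (c : 'rV[R]_n.+1) :
  rV_cons (t + c ord0 ord0, v + \row_j c ord0 (lift ord0 j)) =
  (rV_cons (t, v) : 'rV[R]_n.+1) + c.
Proof.
apply/rowP => i; rewrite [RHS]mxE.
rewrite -[LHS]/(rV_coord i (rV_cons (_, _))).
rewrite -[X in _ = X + _]/(rV_coord i (rV_cons (_, _))).
have [j ->|->] := unliftP ord0 i; last by rewrite !rV_cons0.
by rewrite !rV_consS /rV_coord !mxE.
Qed.

Section chord_line.
Local Open Scope ereal_scope.
Context (R : realType).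

Lemma measurable_line n (th : 'rV[R]_n) : measurable_fun setT
  (fun p : borel_rV R n * measurableTypeR R =>
     (p.1 : 'rV[R]_n) + (p.2 : R) *: th : borel_rV R n)%R.
Proof.
apply: measurable_fun_rV => i.
rewrite (_ : _ \o _ = (fun p => rV_coord i p.1 + (p.2 : R) * th ord0 i)%R).
  apply: measurable_funD.
    exact: measurableT_comp (@measurable_rV_coord R n i) measurable_fst.
  by apply: measurable_funM => //; exact: measurable_snd.
by apply/funext => p /=; rewrite /rV_coord !mxE.
Qed.

Lemma measurable_line1 n (th : 'rV[R]_n) (s : R) : measurable_fun setT
  (fun x : borel_rV R n => (x : 'rV[R]_n) + s *: th : borel_rV R n)%R.
Proof.
exact: measurableT_comp (measurable_line th)
  (pair2_measurable (s : measurableTypeR R)).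
Qed.

Lemma measurable_line2 n (th x : 'rV[R]_n) : measurable_fun setT
  (fun s : measurableTypeR R => x + (s : R) *: th : borel_rV R n)%R.
Proof.
exact: measurableT_comp (measurable_line th)
  (pair1_measurable (x : borel_rV R n)).
Qed.

Lemma measurable_integral_rV_cons n
    (m : {sigma_finite_measure set (borel_rV R n) -> \bar R})
    (f : borel_rV R n.+1 -> \bar R) :
  measurable_fun setT f -> (forall x, 0 <= f x) ->
  measurable_fun setT
    (fun t : measurableTypeR R => \int[m]_v f (rV_cons (t, v))).
Proof.
move=> mf f0.
apply: (@measurable_fun_fubini_tonelli_F _ _ _ _ R m (f \o @rV_cons R n)).
- exact: measurableT_comp mf (@measurable_rV_cons R n).
- by move=> x; exact: f0.
Qed.

Lemma ge0_integral_lebesgue_succ n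
    (m : {sigma_finite_measure set (borel_rV R n) -> \bar R})
    (f : borel_rV R n.+1 -> \bar R) :
  measurable_fun setT f -> (forall x, 0 <= f x) ->
  \int[lebesgue_succ m]_x f x =
  \int[lebesgue_measure]_t \int[m]_v f (rV_cons (t, v)).
Proof.
move=> mf f0; rewrite /lebesgue_succ.
rewrite (@ge0_integral_pushforward _ _ _ _ _ _ (@measurable_rV_cons R n)
  _ setT f)//.
rewrite preimage_setT.
rewrite (@fubini_tonelli1 _ _ _ _ R _ m (f \o @rV_cons R n))//.
- exact: measurableT_comp mf (@measurable_rV_cons R n).
- by move=> x; exact: f0.
Qed.

(** Induction on the dimension: Tonelli splits off the first coordinate, the one-dimensional
    invariance shifts it, and the induction hypothesis shifts the others inside. *)
Lemma ge0_integral_lebesgue_rVD n (c : 'rV[R]_n) (f : borel_rV R n -> \bar R) :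
  measurable_fun setT f -> (forall x, 0 <= f x) ->
  \int[lebesgue_borel_rV R n]_x f ((x : 'rV[R]_n) + c)%R =
  \int[lebesgue_borel_rV R n]_x f x.
Proof.
elim: n c f => [|n IH] c f mf f0.
  by apply: eq_integral => x _; congr f; rewrite [c]thinmx0 addr0.
have mfc : measurable_fun setT
    (fun x : borel_rV R n.+1 => f ((x : 'rV[R]__) + c)%R).
  have := measurable_line1 c 1%R.
  under eq_fun do rewrite scale1r.
  exact: measurableT_comp mf.
have succE (g : borel_rV R n.+1 -> \bar R) :
    measurable_fun setT g -> (forall x, 0 <= g x) ->
  \int[lebesgue_borel_rV R n.+1]_x g x =
  \int[lebesgue_measure]_t \int[lebesgue_borel_rV R n]_v g (rV_cons (t, v)).
  exact: ge0_integral_lebesgue_succ.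
rewrite (succE _ mf f0) (succE _ mfc (fun x => f0 _)).
set m := lebesgue_borel_rV R n in IH *; clearbody m.
rewrite -[RHS](@ge0_integral_lebesgueD _ _ (c ord0 ord0)); last 2 first.
- exact: measurable_integral_rV_cons.
- by move=> t; apply: integral_ge0 => v _; exact: f0.
apply: eq_integral => t _.
rewrite -(IH (\row_j c ord0 (lift ord0 j))%R
            (fun v => f (rV_cons ((t + c ord0 ord0)%R, v)))); last 2 first.
- apply: measurableT_comp mf _.
  exact: measurableT_comp (@measurable_rV_cons R n) (pair1_measurable _).
- by move=> v; exact: f0.
by apply: eq_integral => v _; rewrite rV_consD.
Qed.

End chord_line.

(** * The line integral operator *)

Section line_integral.
Local Open Scope ereal_scope.
Context (R : realType) (n : nat) (th : 'rV[R]_n).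
Implicit Types (f g : borel_rV R n -> \bar R) (x : borel_rV R n).
Local Notation mu := (lebesgue_borel_rV R n).
Local Notation lambda := (@lebesgue_measure R).

(** Runs over the whole line; [K] enters later only through a density extended by zero outside
    it. *)
Definition line_integral f x : \bar R :=
  \int[lambda]_s f ((x : 'rV[R]_n) + (s : R) *: th)%R.

Lemma line_integral_ge0 f x : (forall y, 0 <= f y) -> 0 <= line_integral f x.
Proof. by move=> f0; exact: integral_ge0. Qed.

Lemma measurable_line_restr f x : measurable_fun setT f ->
  measurable_fun [set: measurableTypeR R]
    (fun s => f ((x : 'rV[R]_n) + (s : R) *: th)%R).
Proof. by move=> mf; exact: measurableT_comp mf (measurable_line2 th x). Qed.

Lemma measurable_line_integral f : measurable_fun setT f ->
  (forall y, 0 <= f y) -> measurable_fun setT (line_integral f).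
Proof.
move=> mf f0.
apply: (@measurable_fun_fubini_tonelli_F _ _ _ _ R lambda
  (f \o (fun p : borel_rV R n * measurableTypeR R =>
     (p.1 : 'rV[R]_n) + (p.2 : R) *: th : borel_rV R n)%R)).
- exact: measurableT_comp mf (measurable_line th).
- by move=> p; exact: f0.
Qed.

Lemma line_integral_shift f x (t : R) : measurable_fun setT f ->
  (forall y, 0 <= f y) ->
  line_integral f ((x : 'rV[R]_n) + t *: th)%R = line_integral f x.
Proof.
move=> mf f0; rewrite /line_integral.
rewrite -[RHS](@ge0_integral_lebesgueD _ _ t) //; last exact: measurable_line_restr.
by apply: eq_integral => s _; rewrite -addrA -scalerDl (addrC t).
Qed.

Lemma line_integral_sym f g :
  measurable_fun setT f -> (forall y, 0 <= f y) ->
  measurable_fun setT g -> (forall y, 0 <= g y) ->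
  \int[mu]_x (line_integral f x * g x) = \int[mu]_x (f x * line_integral g x).
Proof.
move=> mf f0 mg g0.
(* For fixed [s], translating [x] by [s *: th] in [G] gives [F], so both have the same integral in
   [x]; Tonelli before and after turns this into the claim. *)
pose F (p : borel_rV R n * measurableTypeR R) :=
  f ((p.1 : 'rV[R]_n) + (p.2 : R) *: th)%R * g p.1.
pose G (p : borel_rV R n * measurableTypeR R) :=
  f p.1 * g ((p.1 : 'rV[R]_n) + (- (p.2 : R)) *: th)%R.
have mF : measurable_fun setT F.
  apply: emeasurable_funM; first exact: measurableT_comp mf (measurable_line th).
  exact: measurableT_comp mg measurable_fst.
have mG : measurable_fun setT G.
  apply: emeasurable_funM; first exact: measurableT_comp mf measurable_fst.
  under eq_fun do rewrite scaleNr -scalerN.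
  exact: measurableT_comp mg (measurable_line (- th)).
have F0 p : 0 <= F p by rewrite mule_ge0.
have G0 p : 0 <= G p by rewrite mule_ge0.
transitivity (\int[mu]_x \int[lambda]_s F (x, s)).
  apply: eq_integral => x _; rewrite /line_integral -ge0_integralZr//.
  exact: measurable_line_restr.
rewrite (@fubini_tonelli _ _ _ _ R mu lambda F)//.
transitivity (\int[lambda]_s \int[mu]_x G (x, s)).
  apply: eq_integral => s _.
  rewrite -(ge0_integral_lebesgue_rVD (s *: th)%R); last 2 first.
  - exact: measurableT_comp mG (pair2_measurable _).
  - by move=> x; exact: G0.
  by apply: eq_integral => x _; rewrite /F /G/= scaleNr addrK.
rewrite -(@fubini_tonelli _ _ _ _ R mu lambda G)//.
apply: eq_integral => x _; rewrite /G/= ge0_integralZl//; last first.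
  under eq_fun do rewrite scaleNr -scalerN.
  exact: measurableT_comp mg (measurable_line2 (- th) x).
congr (_ * _).
(* The translation has reversed the direction of the line; the reflection of [s] restores it. *)
rewrite (@ge0_integral_lebesgueN _ (fun s => g ((x : 'rV[R]_n) + s *: th)%R))//.
exact: measurable_line_restr.
Qed.

End line_integral.

(** * Weighted means along lines *)

Section line_mean.
Local Open Scope ereal_scope.
Context (R : realType) (n : nat) (th : 'rV[R]_n) (r : borel_rV R n -> R).
Hypothesis mr : measurable_fun setT r.
Hypothesis r_ge0 : forall x, (0 <= r x)%R.
Local Notation mu := (lebesgue_borel_rV R n).
Local Notation lambda := (@lebesgue_measure R).
Implicit Types (f g : borel_rV R n -> R) (x : borel_rV R n).

Let mEr : measurable_fun setT (EFin \o r).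
Proof. exact/measurable_EFinP. Qed.

Let Er_ge0 x : 0 <= (EFin \o r) x.
Proof. by rewrite lee_fin. Qed.

(** [fine] sends an infinite weight to 0, whose inverse is 0, so lines of weight 0 and of weight +oo
    are alike: every mean along them is 0. *)
Definition line_weight x : R := fine (line_integral th (EFin \o r) x).

Definition line_mean f x : R :=
  ((line_weight x)^-1 *
    \int[lambda]_s (f ((x : 'rV[R]_n) + (s : R) *: th) *
      r ((x : 'rV[R]_n) + (s : R) *: th)))%R.

(** On nonnegative arguments this version of [line_mean] admits Tonelli, additivity and monotonicity
    without convergence conditions. *)
Definition eline_mean (f : borel_rV R n -> \bar R) x : \bar R :=
  (line_weight x)^-1%:E * line_integral th (fun y => f y * (r y)%:E) x.

Lemma line_weight_ge0 x : (0 <= line_weight x)%R.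
Proof. by rewrite fine_ge0// line_integral_ge0. Qed.

Lemma line_weight_shift x (t : R) :
  line_weight ((x : 'rV[R]_n) + t *: th)%R = line_weight x.
Proof. by rewrite /line_weight line_integral_shift. Qed.

Lemma measurable_line_weight : measurable_fun setT line_weight.
Proof.
apply: measurableT_comp; first exact: fine_measurable.
exact: measurable_line_integral.
Qed.

Lemma measurable_line_weightV : measurable_fun setT (fun x => (line_weight x)^-1)%R.
Proof.
(* On nonnegative reals the inverse, with value 0 at 0, is the power with exponent -1, which is
   measurable. *)
under eq_fun do rewrite -powR_inv1 ?line_weight_ge0//.
exact: measurableT_comp (measurable_powR _) measurable_line_weight.
Qed.

Let mfr (f : borel_rV R n -> \bar R) : measurable_fun setT f ->
  measurable_fun setT (fun y => f y * (r y)%:E).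
Proof. by move=> mf; exact: emeasurable_funM. Qed.

Let fr_ge0 (f : borel_rV R n -> \bar R) :
  (forall y, 0 <= f y) -> forall y, 0 <= f y * (r y)%:E.
Proof. by move=> f0 y; rewrite mule_ge0// lee_fin. Qed.

Lemma eline_mean_ge0 (f : borel_rV R n -> \bar R) x :
  (forall y, 0 <= f y) -> 0 <= eline_mean f x.
Proof.
move=> f0; rewrite mule_ge0// ?lee_fin ?invr_ge0 ?line_weight_ge0//.
exact/line_integral_ge0/fr_ge0.
Qed.

Lemma measurable_eline_mean (f : borel_rV R n -> \bar R) :
  measurable_fun setT f -> (forall y, 0 <= f y) ->
  measurable_fun setT (eline_mean f).
Proof.
move=> mf f0; apply: emeasurable_funM.
  apply/measurable_EFinP; exact: measurable_line_weightV.
by apply: measurable_line_integral; [exact: mfr|exact: fr_ge0].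
Qed.

(** The inverse weight is constant along lines. It can therefore be moved onto [g] before
    [line_integral_sym] is used and pulled out of the line integral afterwards. *)
Lemma eline_mean_sym (f g : borel_rV R n -> \bar R) :
  measurable_fun setT f -> (forall y, 0 <= f y) ->
  measurable_fun setT g -> (forall y, 0 <= g y) ->
  \int[mu]_x (eline_mean f x * g x * (r x)%:E) =
  \int[mu]_x (f x * eline_mean g x * (r x)%:E).
Proof.
move=> mf f0 mg g0.
pose w x : \bar R := (line_weight x)^-1%:E.
have w0 x : 0 <= w x by rewrite lee_fin invr_ge0 line_weight_ge0.
have mw : measurable_fun setT w.
  apply/measurable_EFinP; exact: measurable_line_weightV.
pose G x := w x * (g x * (r x)%:E).
have mG : measurable_fun setT G by apply: emeasurable_funM => //; exact: mfr.
have G0 x : 0 <= G x by rewrite mule_ge0// fr_ge0.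
transitivity (\int[mu]_x (line_integral th (fun y => f y * (r y)%:E) x * G x)).
  apply: eq_integral => x _; rewrite /eline_mean /G -/(w x) -!muleA muleCA.
  by rewrite muleA.
rewrite line_integral_sym//; [|exact: mfr|exact: fr_ge0].
apply: eq_integral => x _.
have -> : line_integral th G x = eline_mean g x.
  rewrite /line_integral /G /w.
  under eq_integral do rewrite line_weight_shift.
  rewrite ge0_integralZl ?lee_fin ?invr_ge0 ?line_weight_ge0//.
    exact: measurable_line_restr (mfr mg).
  by move=> s _; exact: fr_ge0.
by rewrite muleAC.
Qed.

(** The value is 1 on lines of positive finite weight and 0 on all others, hence only an
    inequality. *)
Lemma eline_mean1_le1 x : eline_mean (cst 1) x <= 1.
Proof.
rewrite /eline_mean /line_weight.
have -> : (fun y => cst 1 y * (r y)%:E) = EFin \o r.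
  by apply/funext => y /=; rewrite mul1e.
have := @line_integral_ge0 _ _ th (EFin \o r) x Er_ge0.
case: line_integral => [a|_|//]; last by rewrite /= invr0 mul0e.
rewrite lee_fin le_eqVlt => /predU1P[<-|a0] /=; first by rewrite invr0 mul0e.
by rewrite -EFinM mulVf// gt_eqF.
Qed.

Lemma eline_meanD (f g : borel_rV R n -> \bar R) x :
  measurable_fun setT f -> (forall y, 0 <= f y) ->
  measurable_fun setT g -> (forall y, 0 <= g y) ->
  eline_mean (f \+ g) x = eline_mean f x + eline_mean g x.
Proof.
move=> mf f0 mg g0; rewrite /eline_mean -ge0_muleDr.
- congr (_ * _); rewrite /line_integral -ge0_integralD//.
  + by apply: eq_integral => s _; rewrite ge0_muleDl.
  + by move=> s _; exact: fr_ge0.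
  + exact: measurable_line_restr (mfr mf).
  + by move=> s _; exact: fr_ge0.
  + exact: measurable_line_restr (mfr mg).
- exact/line_integral_ge0/fr_ge0.
- exact/line_integral_ge0/fr_ge0.
Qed.

Lemma eline_meanZl (k : \bar R) (f : borel_rV R n -> \bar R) x : 0 <= k ->
  measurable_fun setT f -> (forall y, 0 <= f y) ->
  eline_mean (fun y => k * f y) x = k * eline_mean f x.
Proof.
move=> k0 mf f0; rewrite /eline_mean muleCA; congr (_ * _).
rewrite /line_integral -ge0_integralZl//.
- by apply: eq_integral => s _; rewrite muleA.
- exact: measurable_line_restr (mfr mf).
- by move=> s _; exact: fr_ge0.
Qed.

Lemma le_eline_mean (f g : borel_rV R n -> \bar R) x :
  measurable_fun setT f -> (forall y, 0 <= f y) ->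
  measurable_fun setT g -> (forall y, f y <= g y) ->
  eline_mean f x <= eline_mean g x.
Proof.
move=> mf f0 mg fg; apply: lee_wpmul2l.
  by rewrite lee_fin invr_ge0 line_weight_ge0.
apply: ge0_le_integral => //.
- by move=> s _; exact: fr_ge0.
- exact: measurable_line_restr (mfr mf).
- exact: measurable_line_restr (mfr mg).
- by move=> s _; rewrite lee_wpmul2r ?lee_fin.
Qed.

(** Reduces measurability and shift invariance of the mean of a signed function to line integrals of
    nonnegative ones. *)
Let line_meanE f : let F := fun y => (f y * r y)%:E in
  line_mean f = (fun x => (line_weight x)^-1 *
    fine (line_integral th F^\+ x - line_integral th F^\- x)%E)%R.
Proof.
move=> F; apply/funext => x; congr (_ * fine _)%R; rewrite integralE; congr (_ - _).
- by apply: eq_integral => s _; rewrite !funeposE.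
- by apply: eq_integral => s _; rewrite !funenegE.
Qed.

Let measurable_funM_EFin f : measurable_fun setT f ->
  measurable_fun setT (fun y => (f y * r y)%:E).
Proof. by move=> mf; apply/measurable_EFinP; exact: measurable_funM. Qed.

Lemma measurable_line_mean f : measurable_fun setT f ->
  measurable_fun setT (line_mean f).
Proof.
move=> /measurable_funM_EFin mF.
rewrite line_meanE.
apply: measurable_funM; first exact: measurable_line_weightV.
apply: measurableT_comp; first exact: fine_measurable.
apply: emeasurable_funB; apply: measurable_line_integral.
- exact: measurable_funepos.
- exact: funepos_ge0.
- exact: measurable_funeneg.
- exact: funeneg_ge0.
Qed.

Lemma line_mean_shift f x (t : R) : measurable_fun setT f ->
  line_mean f ((x : 'rV[R]_n) + t *: th)%R = line_mean f x.
Proof.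
move=> /measurable_funM_EFin mF.
rewrite !line_meanE line_weight_shift.
rewrite (@line_integral_shift _ _ th _ x t (measurable_funepos mF) (funepos_ge0 _)).
by rewrite (@line_integral_shift _ _ th _ x t
  (measurable_funeneg mF) (funeneg_ge0 _)).
Qed.

Let line_integrable f x : measurable_fun setT f ->
  line_integral th (fun y => `|f y|%:E * (r y)%:E) x < +oo ->
  lambda.-integrable setT (fun s =>
   (f ((x : 'rV[R]_n) + (s : R) *: th) * r ((x : 'rV[R]_n) + (s : R) *: th))%:E)%R.
Proof.
move=> mf foo; apply/integrableP; split.
  exact: (measurable_line_restr th x (measurable_funM_EFin mf)).
apply: le_lt_trans foo; rewrite /line_integral le_eqVlt; apply/orP; left; apply/eqP.
by apply: eq_integral => s _; rewrite /= normrM (ger0_norm (r_ge0 _)) EFinM.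
Qed.

(** A positive inverse weight times +oo would be +oo. With weight 0 the mean is 0 and says nothing
    about the line integral. *)
Let finite_line f x : line_weight x != 0%R ->
  eline_mean (fun y => `|f y|%:E) x < +oo ->
  line_integral th (fun y => `|f y|%:E * (r y)%:E) x < +oo.
Proof.
move=> w0; rewrite /eline_mean.
case: line_integral => [a _|//|//]; first by rewrite ltry.
by rewrite gt0_muley ?lte_fin// invr_gt0 lt_neqAle eq_sym w0 line_weight_ge0.
Qed.

Lemma line_mean_idem f : measurable_fun setT f ->
  line_mean (line_mean f) = line_mean f.
Proof.
move=> mf; apply/funext => x; rewrite {1}/line_mean.
(* The inner mean is constant along the line; once taken out of the integral, it leaves the weight,
   which cancels. *)
under eq_Rintegral do rewrite line_mean_shift//.
have [w0|w0] := eqVneq (line_weight x) 0%R.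
  by rewrite w0 invr0 mul0r /line_mean w0 invr0 mul0r.
rewrite RintegralZl//; last first.
  apply/integrableP; split.
    exact: (measurable_line_restr th x mEr).
  (* A nonzero [line_weight] excludes the value +oo, which [fine] would have sent to 0. *)
  move: w0; rewrite /line_weight /line_integral.
  under [in X in _ -> X]eq_integral do rewrite /= ger0_norm//.
  by case: integral => //=; rewrite ?eqxx// => a; rewrite ltry.
by rewrite mulrCA -/(line_weight x) mulVf// mulr1.
Qed.

Lemma abs_line_mean_le f x : measurable_fun setT f ->
  `|line_mean f x|%:E <= eline_mean (fun y => `|f y|%:E) x.
Proof.
move=> mf; rewrite /line_mean normrM EFinM ger0_norm ?invr_ge0 ?line_weight_ge0//.
apply: lee_wpmul2l; first by rewrite lee_fin invr_ge0 line_weight_ge0.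
rewrite /Rintegral; set I := integral _ _ _.
(* [fine] can only lower the absolute value, since infinite values become 0. *)
apply: (@le_trans _ _ `|I|); first by case: I => //= *; rewrite leey.
apply: le_trans (le_abse_integral _ _ _) _ => //.
  exact: (measurable_line_restr th x (measurable_funM_EFin mf)).
rewrite le_eqVlt; apply/orP; left; apply/eqP.
by apply: eq_integral => s _; rewrite /= normrM (ger0_norm (r_ge0 _)) EFinM.
Qed.

Lemma line_mean_ge0E f x : measurable_fun setT f -> (forall y, 0 <= f y)%R ->
  eline_mean (EFin \o f) x < +oo -> (line_mean f x)%:E = eline_mean (EFin \o f) x.
Proof.
move=> mf f0 foo; rewrite /line_mean EFinM /eline_mean.
have [w0|w0] := eqVneq (line_weight x) 0%R; first by rewrite w0 invr0 !mul0e.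
congr (_ * _); rewrite /Rintegral fineK//.
have : eline_mean (fun y => `|f y|%:E) x < +oo.
  by under eq_fun do rewrite ger0_norm//.
by move=> /(finite_line w0) /(line_integrable mf) /integrable_fin_num; exact.
Qed.

Lemma line_mean_linear (a : R) f g x :
  measurable_fun setT f -> measurable_fun setT g ->
  eline_mean (fun y => `|f y|%:E) x < +oo ->
  eline_mean (fun y => `|g y|%:E) x < +oo ->
  line_mean (fun y => a * f y + g y)%R x = (a * line_mean f x + line_mean g x)%R.
Proof.
move=> mf mg foo goo; rewrite /line_mean.
have [->|w0] := eqVneq (line_weight x) 0%R.
  by rewrite invr0 !mul0r mulr0 addr0.
have If := line_integrable mf (finite_line w0 foo).
have Ig := line_integrable mg (finite_line w0 goo).
under eq_Rintegral do rewrite mulrDl -mulrA.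
rewrite RintegralD//; last first.
  by apply: eq_integrable (integrableZl measurableT a If) => // s _;
    rewrite /= EFinM.
by rewrite RintegralZl// mulrDr mulrCA.
Qed.

(* Jensen's inequality for squares, by integrating [2 a f <= f^2 + a^2] with
   [a] the mean of [f] *)
Lemma line_mean_sqr_le f x : measurable_fun setT f -> (forall y, 0 <= f y)%R ->
  eline_mean (EFin \o f) x < +oo ->
  (line_mean f x ^+ 2)%:E <= eline_mean (fun y => (f y ^+ 2)%:E) x.
Proof.
move=> mf f0 foo; have fE := line_mean_ge0E mf f0 foo.
set a := line_mean f x in fE *; clearbody a.
have a0 : (0 <= a)%R by rewrite -lee_fin fE eline_mean_ge0// => y; rewrite lee_fin.
have mEf : measurable_fun setT (EFin \o f) by exact/measurable_EFinP.
have Ef0 y : 0 <= (EFin \o f) y by rewrite lee_fin.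
have mf2 : measurable_fun setT (fun y => (f y ^+ 2)%:E).
  by apply/measurable_EFinP; exact: measurable_funX.
have f20 y : 0 <= (f y ^+ 2)%:E by rewrite lee_fin sqr_ge0.
have : (2 * a)%:E * eline_mean (EFin \o f) x <=
    eline_mean (fun y => (f y ^+ 2)%:E) x + (a ^+ 2)%:E * eline_mean (cst 1) x.
  rewrite -eline_meanZl ?lee_fin ?mulr_ge0//.
  rewrite -eline_meanZl ?lee_fin ?sqr_ge0//.
  rewrite -eline_meanD//; last by move=> y; rewrite mule1 lee_fin sqr_ge0.
  apply: le_eline_mean.
  - exact: measurable_funeM.
  - by move=> y; rewrite mule_ge0// lee_fin mulr_ge0.
  - by apply: emeasurable_funD => //; exact: measurable_funeM.
  - move=> y /=; rewrite mule1 -EFinM -EFinD lee_fin -subr_ge0.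
    have -> : (f y ^+ 2 + a ^+ 2 - 2 * a * f y = (f y - a) ^+ 2)%R by ring.
    exact: sqr_ge0.
rewrite -fE -EFinM.
(* The mean of 1 being at most 1, one of the two copies of a^2 on the left cancels the term on the
   right. *)
have : (a ^+ 2)%:E * eline_mean (cst 1) x <= (a ^+ 2)%:E.
  by rewrite -[leRHS]mule1 lee_wpmul2l ?lee_fin ?sqr_ge0 ?eline_mean1_le1.
move: (eline_mean (fun y => (f y ^+ 2)%:E) x) ((a ^+ 2)%:E * eline_mean _ x).
move=> [b||] [c||]//; rewrite ?addNye ?addeNy ?leey//.
by rewrite -EFinD !lee_fin; nra.
Qed.

End line_mean.

(** * Borel versions of sets and functions measurable for the completion *)

Lemma ae_forall_countable d (T : measurableType d) (R : realType)
    (mu : {measure set T -> \bar R}) (I : countType) (P : I -> T -> Prop) :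
  (forall i, \forall x \ae mu, P i x) -> \forall x \ae mu, forall i, P i x.
Proof.
(* Natural numbers that code no index get a trivial property. *)
move=> aP; pose Q n x := if @unpickle I n is Some i then P i x else True.
have : \forall x \ae mu, forall n, Q n x.
  apply/ae_foralln => n; rewrite /Q.
  by case: unpickle => [i|]; [exact: aP|exact: aeW].
by apply: filterS => x Qx i; have := Qx (pickle i); rewrite /Q pickleK.
Qed.

Section completion.
Local Open Scope ereal_scope.
Context d (T : measurableType d) (R : realType).
Variable mu : {sigma_finite_measure set T -> \bar R}.
Local Notation cT := (caratheodory_type (mu_ext mu)).
Local Notation cmu := (@completed_measure_extension _ T R mu).

Lemma measurable_completed (A : set T) :
  measurable A -> measurable (A : set cT).
Proof. exact: caratheodory_measurable_mu_ext. Qed.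

Lemma completed_measureE (A : set T) : measurable A -> cmu A = mu A.
Proof. exact: measurable_mu_extE. Qed.

Lemma measurable_id_completed : measurable_fun setT (id : cT -> T).
Proof. by move=> _ A mA; rewrite setTI; exact: measurable_completed. Qed.

Lemma measurable_fun_completed d' (U : measurableType d') (f : T -> U) :
  measurable_fun setT f -> measurable_fun setT (f : cT -> U).
Proof.
by move=> mf; exact: (measurableT_comp mf measurable_id_completed).
Qed.

(** [cmu A] is an infimum over countable measurable covers. Finiteness provides covers optimal up to
    1/(n+1), and [B] is the intersection of their unions. *)
Lemma completed_hull (A : set cT) : cmu A < +oo ->
  exists B : set T, [/\ measurable B, A `<=` B & mu B = cmu A].
Proof.
move=> Aoo; have Afin : cmu A \is a fin_num.
  by rewrite ge0_fin_numE//; exact: outer_measure_ge0.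
have cover n : {F : (set T)^nat | @measurable_cover _ T A F &
    \sum_(k <oo) mu (F k) < cmu A + n.+1%:R^-1%:E}.
  have n0 : (0 < n.+1%:R^-1 :> R)%R by rewrite invr_gt0.
  apply: cid2.
  have [x [F FA Fx] FE] := lb_ereal_inf_adherent n0 Afin.
  by exists F => //; move: FE; rewrite -Fx.
pose B := \bigcap_n \bigcup_k (s2val (cover n) k).
have mF n k : measurable (s2val (cover n) k) by have [] := s2valP (cover n).
have AF n : A `<=` \bigcup_k (s2val (cover n) k) by have [] := s2valP (cover n).
have mB : measurable B.
  by apply: bigcapT_measurable => n; exact: bigcupT_measurable.
have AB : A `<=` B by move=> x Ax n _; exact: AF.
exists B; split => //; apply/eqP; rewrite eq_le; apply/andP; split; last first.
  by rewrite -completed_measureE//; exact: le_outer_measure.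
apply/lee_addgt0Pr => _/posnumP[e]; near \oo => n.
apply: (@le_trans _ _ (mu (\bigcup_k s2val (cover n) k))).
  apply: le_measure; rewrite ?inE//; first exact: bigcupT_measurable.
  exact: bigcap_inf.
apply: (@le_trans _ _ (\sum_(k <oo) mu (s2val (cover n) k))).
  by apply: measure_sigma_subadditive => //; exact: bigcupT_measurable.
rewrite (le_trans (ltW (s2valP' (cover n))))// leeD2l// lee_fin ltW//.
by near: n; exact: near_infty_natSinv_lt.
Unshelve. all: by end_near. Qed.

Lemma ae_completedP (P : T -> Prop) : (\forall x \ae cmu, P x) ->
  exists N : set T, [/\ measurable N, mu N = 0 & forall x, ~ N x -> P x].
Proof.
move=> [A [mA A0 PA]].
have [|B [mB AB B0]] := @completed_hull A; first by rewrite [X in X < _]A0 ltry.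
exists B; split => //; first by rewrite B0.
by move=> x Bx; apply: contrapT => Px; apply/Bx/AB/PA.
Qed.

Lemma ae_completed (P : T -> Prop) :
  (\forall x \ae mu, P x) -> \forall x \ae cmu, P x.
Proof.
move=> [N [mN N0 PN]]; exists N; split => //.
  exact: measurable_completed.
by rewrite -N0; exact: completed_measureE.
Qed.

Lemma completed_set_ae (A : set cT) : measurable A ->
  exists B : set T, measurable B /\ \forall x \ae mu, A x <-> B x.
Proof.
have finite_case (C : set cT) : measurable C -> cmu C < +oo ->
  exists B : set T, [/\ measurable B, C `<=` B & mu.-negligible (B `\` C)].
  move=> mC Coo; have [B [mB CB BC]] := completed_hull Coo.
  exists B; split => //.
  have mBC : measurable (B `\` C : set cT).
    by apply: measurableD => //; exact: measurable_completed.
  have BC0 : cmu (B `\` C) = 0.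
    rewrite measureD//=; last 2 first.
    - exact: measurable_completed.
    - by rewrite completed_measureE// BC.
    rewrite setIidr// completed_measureE// BC subee// ge0_fin_numE//.
  (* The difference is measurable only for the completion; a second hull makes it negligible for
     [mu]. *)
  have [|N [mN BCN N0]] := @completed_hull (B `\` C); first by rewrite BC0 ltry.
  by exists N; split => //; rewrite N0.
move=> mA.
have /sigma_finiteP[F [FT ndF Foo]] := sigma_finiteT mu.
(* Hulls exist in finite measure only, so [A] is cut along an exhaustion by sets of finite
   measure. *)
have h k : {B : set T | measurable B /\ A `&` F k `<=` B /\
    mu.-negligible (B `\` (A `&` F k))}.
  have [mFk Fkoo] := Foo k.
  have mAF : measurable (A `&` F k : set cT).
    by apply: measurableI => //; exact: measurable_completed.
  apply: cid; have [|B [? ? ?]] := finite_case _ mAF; last by exists B.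
  apply: (@le_lt_trans _ _ (cmu (F k))); last by rewrite completed_measureE.
  by apply: le_outer_measure; exact: subIsetr.
exists (\bigcup_k sval (h k)); split.
  by apply: bigcupT_measurable => k; case: (svalP (h k)).
have : mu.-negligible (\bigcup_k (sval (h k) `\` (A `&` F k))).
  by apply: negligible_bigcup => k; case: (svalP (h k)) => _ [].
apply: negligibleS => x /= nAB; apply: contrapT => nU; apply: nAB; split.
- move=> Ax; have [k _ Fk] : (\bigcup_k F k) x by rewrite -FT.
  by exists k => //; case: (svalP (h k)) => _ [+ _]; apply.
- move=> [k _ hk]; apply: contrapT => nAx; apply: nU.
  by exists k => //; split => // -[].
Qed.

(** Only the sublevel sets at rational levels are replaced by Borel sets; being countably many, they
    share one exceptional null set, and density of the rationals recovers all levels. *)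
Lemma completed_fun_ae (f : cT -> R) : measurable_fun setT f ->
  exists g : T -> R, measurable_fun setT g /\ \forall x \ae mu, f x = g x.
Proof.
move=> mf.
have h (q : rat) : {B : set T | measurable B /\
    \forall x \ae mu, (f x < ratr q)%R <-> B x}.
  apply/cid/(@completed_set_ae [set x | f x < ratr q]%R).
  rewrite -[X in measurable X]setTI.
  have -> : [set x | f x < ratr q]%R = f @^-1` `]-oo, ratr q[%classic.
    by apply/seteqP; split => x /=; rewrite in_itv.
  exact: mf.
have := @ae_forall_countable _ _ _ mu _ _ (fun q => proj2 (svalP (h q))).
move=> [N [mN N0 subN]].
have {subN}fN x : ~ N x -> forall q, (f x < ratr q)%R <-> sval (h q) x.
  by move=> Nx; apply: contrapT => nP; exact/Nx/subN.
pose g x := if x \in N then 0%R else f x.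
exists g; split; last first.
  exists N; split => // x /= gx; apply: contrapT => Nx; apply: gx.
  by rewrite /g memNset.
move=> mT; apply: (measurability _ (RGenInftyO.measurableE R)) => //.
move=> _ [_ [y ->] <-]; rewrite setTI.
(* On [N] the function [g] is 0, so [N] belongs to the sublevel set exactly when [y] is positive. *)
have -> : g @^-1` `]-oo, y[%classic =
    (\bigcup_(q in [set q : rat | (ratr q < y)%R]) (sval (h q) `\` N)) `|`
    (N `&` [set _ | 0 < y]%R).
  apply/seteqP; split => x /=; rewrite in_itv/= /g; case: ifPn.
  - by move=> /set_mem Nx y0; right.
  - move=> /negP; rewrite in_setE => Nx fxy; left.
    have [q fq qy] : exists2 q, (f x < ratr q)%R & (ratr q < y)%R.
      have [q] := rat_in_itvoo fxy.
      by rewrite in_itv/= => /andP[? ?]; exists q.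
    exists q => //; split => //.
    by apply/(fN x Nx q).
  - by move=> /set_mem Nx [[q _ [_ /(_ Nx)]]//|[]].
  - move=> /negP; rewrite in_setE => Nx [[q /= qy [hq _]]|[]//].
    by apply: lt_trans qy; exact/(fN x Nx q).
apply: measurableU; last first.
  have [y0|y0] := boolP (0 < y)%R.
    by rewrite (_ : [set _ | _] = setT) ?setIT//; exact/seteqP.
  rewrite (_ : [set _ | _] = set0) ?setI0//; apply/seteqP.
  by split => // x /=; rewrite (negbTE y0).
rewrite bigcup_mkcond; apply: bigcupT_measurable_rat => q.
case: ifPn => // _; apply: measurableD => //.
by have [] := svalP (h q).
Qed.

End completion.

(** * Integration against a measure with a density *)

Section density.
Local Open Scope ereal_scope.
Context d (T : measurableType d) (R : realType).
Variables (mu nu : {measure set T -> \bar R}) (r : T -> R).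
Hypothesis mr : measurable_fun setT r.
Hypothesis r_ge0 : forall x, (0 <= r x)%R.
Hypothesis nuE : forall A, measurable A -> nu A = \int[mu]_(x in A) (r x)%:E.

Import HBNNSimple.

Let nnsfun_density (g : {nnsfun T >-> R}) :
  \int[nu]_x (g x)%:E = \int[mu]_x ((g x)%:E * (r x)%:E).
Proof.
have mgy y : measurable (g @^-1` [set y]) by exact: measurable_funPTI.
have mEr : measurable_fun setT (EFin \o r) by exact/measurable_EFinP.
rewrite integralT_nnsfun sintegralE.
under [RHS]eq_integral => x _.
  rewrite fimfunE -fsumEFin// ge0_mule_fsuml; last first.
    by move=> y; exact: nnfun_muleindic_ge0.
  over.
rewrite ge0_integral_fsum//; last 2 first.
- move=> y; apply: emeasurable_funM => //.
  by apply/measurable_EFinP; exact: measurable_funM.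
- by move=> y x _; rewrite mule_ge0 ?nnfun_muleindic_ge0// lee_fin.
apply: eq_fsbigr => y /set_mem[x0 _ gx0].
have y0 : (0 <= y)%R by rewrite -gx0.
under [RHS]eq_integral do rewrite EFinM -muleA.
rewrite ge0_integralZl//; last 2 first.
- by apply: emeasurable_funM => //; exact/measurable_EFinP.
- by move=> x _; rewrite mule_ge0// lee_fin.
congr (_ * _); rewrite nuE// integral_mkcond; apply: eq_integral => x _.
by rewrite epatch_indic muleC.
Qed.

(** The density is given on sets only; simple functions and monotone convergence extend it to
    integrals. *)
Lemma ge0_integral_density (h : T -> \bar R) : measurable_fun setT h ->
  (forall x, 0 <= h x) -> \int[nu]_x h x = \int[mu]_x (h x * (r x)%:E).
Proof.
move=> mh h0; pose g := nnsfun_approx measurableT mh.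
have gh x : (EFin \o g^~ x) n @[n --> \oo] --> h x by exact: cvg_nnsfun_approx.
have ndg x : {homo g^~ x : m n / (m <= n)%N >-> (m <= n)%R}.
  by move=> m n mn; exact/lefP/nd_nnsfun_approx.
transitivity (limn (fun n => \int[nu]_x (g n x)%:E)).
  rewrite -monotone_convergence//.
  - by apply: eq_integral => x _; apply/esym/cvg_lim => //; exact: gh.
  - by move=> n; apply/measurable_EFinP; exact: measurable_funP.
  - by move=> n x _; rewrite lee_fin.
  - by move=> x _ m n mn; rewrite lee_fin ndg.
under eq_fun do rewrite nnsfun_density.
rewrite -monotone_convergence//.
- apply: eq_integral => x _; apply/cvg_lim => //.
  by apply: cvgeZr => //; exact: gh.
- move=> n; apply: emeasurable_funM; apply/measurable_EFinP => //.
- by move=> n x _; rewrite mule_ge0 ?lee_fin.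
- by move=> x _ m n mn; rewrite lee_wpmul2r ?lee_fin// ndg.
Qed.

End density.

(** * Null sets and almost every line *)

Lemma ge0_integral_eq0_ae d (T : measurableType d) (R : realType)
    (mu : {measure set T -> \bar R}) (f : T -> \bar R) :
  measurable_fun setT f -> (forall x, 0 <= f x)%E ->
  (\int[mu]_x f x = 0)%E -> \forall x \ae mu, f x = 0%E.
Proof.
move=> mf f0 If0.
have /(ae_eq_integral_abs _ measurableT mf) : (\int[mu]_x `|f x| = 0)%E.
  by under eq_integral do rewrite gee0_abs//.
by apply: filterS => x; exact.
Qed.

Lemma integrable_ae_lty d (T : measurableType d) (R : realType)
    (mu : {measure set T -> \bar R}) (f : T -> \bar R) :
  measurable_fun setT f -> (forall x, 0 <= f x)%E ->
  (\int[mu]_x f x < +oo)%E -> \forall x \ae mu, (f x < +oo)%E.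
Proof.
move=> mf f0 Ifoo.
have /integrable_ae : mu.-integrable setT f.
  apply/integrableP; split => //.
  by under eq_integral do rewrite gee0_abs//.
move=> /(_ measurableT); apply: filterS => x /(_ I).
by rewrite ge0_fin_numE.
Qed.

Section ae_line.
Local Open Scope ereal_scope.
Context (R : realType) (n : nat) (th : 'rV[R]_n).

(** By symmetry the integral of T 1_N is the integral of T 1 over N. The latter is 0 because N is
    null, although T 1 is +oo everywhere. Hence T 1_N vanishes almost everywhere. *)
Lemma ae_line (P : borel_rV R n -> Prop) :
  (\forall x \ae lebesgue_borel_rV R n, P x) ->
  \forall x \ae lebesgue_borel_rV R n,
    \forall s \ae @lebesgue_measure R, P ((x : 'rV[R]_n) + (s : R) *: th)%R.
Proof.
move=> [N [mN N0 PN]].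
pose f (x : borel_rV R n) : \bar R := (\1_N x)%:E.
have mf : measurable_fun setT f by exact/measurable_EFinP.
have f0 x : 0 <= f x by rewrite lee_fin.
have : \forall x \ae lebesgue_borel_rV R n, line_integral th f x = 0.
  apply: ge0_integral_eq0_ae.
  - exact: measurable_line_integral.
  - by move=> x; exact: line_integral_ge0.
  under eq_integral do rewrite -[line_integral _ _ _]mule1.
  rewrite (@line_integral_sym _ _ th f (cst 1))//.
  transitivity (\int[lebesgue_borel_rV R n]_(x in N) line_integral th (cst 1) x).
    rewrite [RHS]integral_mkcond; apply: eq_integral => x _.
    by rewrite epatch_indic muleC.
  apply: null_set_integral => //.
  by apply: measurable_funTS; exact: measurable_line_integral.
apply: filterS => x fx0.
have : \forall s \ae @lebesgue_measure R, f ((x : 'rV[R]_n) + (s : R) *: th)%R = 0.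
  apply: ge0_integral_eq0_ae => //.
  exact: measurable_line_restr mf.
apply: (@filterS _ _ (ae_filter_ringOfSetsType lebesgue_measure)) => s.
rewrite /f indicE => -[] /eqP.
case: (boolP (_ \in N)); first by rewrite oner_eq0.
by rewrite notin_setE => Nx _; apply: contrapT => nP; exact/Nx/PN.
Qed.

End ae_line.

(** * Square-integrable functions and their inner product *)

Section Lfun2.
Context d (T : measurableType d) (R : realType).
Variable mu : {measure set T -> \bar R}.
Implicit Types f g : T -> R.

Lemma Lfun2_measurable f : f \in Lfun mu 2%:E -> measurable_fun setT f.
Proof. by move=> /sub_Lfun_mfun; rewrite inE. Qed.

Lemma Lfun2P f : measurable_fun setT f ->
  (\int[mu]_x (f x ^+ 2)%:E < +oo)%E <-> f \in Lfun mu 2%:E.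
Proof.
move=> mf; split=> [foo|f2].
- rewrite inE; apply/andP; split; rewrite inE//= /finite_norm unlock.
  apply: poweR_lty; apply: le_lt_trans foo.
  rewrite le_eqVlt; apply/orP; left; apply/eqP; apply: eq_integral => x _.
  by rewrite /= powR_mulrn// real_normK// num_real.
- have /integrableP[_] := Lfun2_integrable_sqr f2.
  apply: le_lt_trans; rewrite le_eqVlt; apply/orP; left; apply/eqP.
  by apply: eq_integral => x _; rewrite /= ger0_norm// sqr_ge0.
Qed.

Lemma Lfun2_le f g : measurable_fun setT f -> g \in Lfun mu 2%:E ->
  (\int[mu]_x (f x ^+ 2)%:E <= \int[mu]_x (g x ^+ 2)%:E)%E ->
  f \in Lfun mu 2%:E.
Proof.
move=> mf g2 fg; apply/(Lfun2P mf); apply: le_lt_trans fg _.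
by apply/Lfun2P => //; exact: Lfun2_measurable.
Qed.

Lemma ae_sqr_integral f g : measurable_fun setT f -> measurable_fun setT g ->
  f = g %[ae mu] ->
  (\int[mu]_x (f x ^+ 2)%:E = \int[mu]_x (g x ^+ 2)%:E)%E.
Proof.
move=> mf mg fg; apply: ae_eq_integral => //.
- by apply/measurable_EFinP; exact: measurable_funX.
- by apply/measurable_EFinP; exact: measurable_funX.
- by apply: filterS fg => x /[apply] ->.
Qed.

Lemma Lfun2_ae f g : measurable_fun setT f -> measurable_fun setT g ->
  f = g %[ae mu] -> g \in Lfun mu 2%:E -> f \in Lfun mu 2%:E.
Proof.
move=> mf mg fg g2; apply: (Lfun2_le mf g2).
by rewrite (ae_sqr_integral mf mg fg).
Qed.

Lemma Lfun2_linear (a : R) f g : f \in Lfun mu 2%:E -> g \in Lfun mu 2%:E ->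
  (fun x => a * f x + g x) \in Lfun mu 2%:E.
Proof.
move=> f2 g2; have mf := Lfun2_measurable f2; have mg := Lfun2_measurable g2.
apply/Lfun2P; first by apply: measurable_funD => //; exact: measurable_funM.
have mX (h : T -> R) : measurable_fun setT h ->
    measurable_fun setT (fun x => (h x ^+ 2)%:E).
  by move=> mh; apply/measurable_EFinP; exact: measurable_funX.
apply: (@le_lt_trans _ _
  (\int[mu]_x ((2 * a ^+ 2)%:E * (f x ^+ 2)%:E + 2%:E * (g x ^+ 2)%:E))%E).
  apply: ge0_le_integral => //.
  - by move=> x _; rewrite lee_fin sqr_ge0.
  - by apply: mX; apply: measurable_funD => //; exact: measurable_funM.
  - by apply: emeasurable_funD; apply: measurable_funeM; exact: mX.
  - move=> x _; rewrite -!EFinM -EFinD lee_fin -subr_ge0.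
    have -> : 2 * a ^+ 2 * f x ^+ 2 + 2 * g x ^+ 2 - (a * f x + g x) ^+ 2 =
      (a * f x - g x) ^+ 2 by ring.
    exact: sqr_ge0.
have a0 : 0 <= 2 * a ^+ 2 by rewrite mulr_ge0// sqr_ge0.
rewrite ge0_integralD//; last 4 first.
- by move=> x _; rewrite mule_ge0 ?lee_fin// sqr_ge0.
- by apply: measurable_funeM; exact: mX.
- by move=> x _; rewrite mule_ge0 ?lee_fin// sqr_ge0.
- by apply: measurable_funeM; exact: mX.
rewrite !ge0_integralZl ?lee_fin//;
  try (by move=> x _; rewrite lee_fin sqr_ge0); try exact: mX.
by rewrite lte_add_pinfty// lte_mul_pinfty//; exact/Lfun2P.
Qed.

Lemma Lfun2_cst0 : (fun=> 0 : R) \in Lfun mu 2%:E.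
Proof.
apply/Lfun2P => //; under eq_integral do rewrite expr0n/=.
by rewrite integral0 ltry.
Qed.

Lemma Lfun2_max0 f : f \in Lfun mu 2%:E ->
  (fun x => Num.max (f x) 0) \in Lfun mu 2%:E.
Proof.
move=> f2; have mf := Lfun2_measurable f2.
apply: Lfun2_le (f2) _; first exact: measurable_maxr.
apply: ge0_le_integral => //.
- by move=> x _; rewrite lee_fin sqr_ge0.
- by apply/measurable_EFinP; apply: measurable_funX; exact: measurable_maxr.
- by apply/measurable_EFinP; exact: measurable_funX.
- move=> x _; rewrite lee_fin; case: (leP (f x) 0) => // _.
  by rewrite expr0n sqr_ge0.
Qed.

Lemma Lfun2M_integrable f g : f \in Lfun mu 2%:E -> g \in Lfun mu 2%:E ->
  mu.-integrable setT (EFin \o (fun x => f x * g x)).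
Proof. by move=> f2 g2; apply/Lfun1_integrable; exact: Lfun2_mul_Lfun1. Qed.

Lemma L2_innerC f g : L2_inner mu f g = L2_inner mu g f.
Proof. by apply: eq_Rintegral => x _; rewrite mulrC. Qed.

Lemma L2_inner_ge0 f : 0 <= L2_inner mu f f.
Proof. by apply: Rintegral_ge0 => x _; rewrite -expr2 sqr_ge0. Qed.

Lemma L2_inner_ael f g h : measurable_fun setT f -> measurable_fun setT g ->
  measurable_fun setT h -> f = g %[ae mu] -> L2_inner mu f h = L2_inner mu g h.
Proof.
move=> mf mg mh fg; congr fine; apply: ae_eq_integral => //.
- by apply/measurable_EFinP; exact: measurable_funM.
- by apply/measurable_EFinP; exact: measurable_funM.
- by apply: filterS fg => x /[apply] ->.
Qed.

Lemma L2_inner_linearl (a : R) f g h : f \in Lfun mu 2%:E ->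
  g \in Lfun mu 2%:E -> h \in Lfun mu 2%:E ->
  L2_inner mu (fun x => a * f x + g x) h =
  a * L2_inner mu f h + L2_inner mu g h.
Proof.
move=> f2 g2 h2; rewrite /L2_inner.
have fh := Lfun2M_integrable f2 h2; have gh := Lfun2M_integrable g2 h2.
under eq_Rintegral do rewrite mulrDl -mulrA.
rewrite RintegralD ?RintegralZl//.
by apply: eq_integrable (integrableZl measurableT a fh) => // x _; rewrite /= EFinM.
Qed.

Lemma L2_inner_linearr (a : R) f g h : f \in Lfun mu 2%:E ->
  g \in Lfun mu 2%:E -> h \in Lfun mu 2%:E ->
  L2_inner mu h (fun x => a * f x + g x) =
  a * L2_inner mu h f + L2_inner mu h g.
Proof. by move=> f2 g2 h2; rewrite !(L2_innerC h) L2_inner_linearl. Qed.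

End Lfun2.

(** * Sums of positive operators, and projections *)

Section positive_operators.
Context d (T : measurableType d) (R : realType).
Variable mu : {measure set T -> \bar R}.
Implicit Types (P Q : (T -> R) -> T -> R) (f g : T -> R).

Lemma positive_operator0 : positive_operator mu (fun _ _ => 0).
Proof.
have in0 f : L2_inner mu (fun=> 0) f = 0.
  rewrite /L2_inner; under eq_Rintegral do rewrite mul0r.
  by rewrite Rintegral_cst ?mul0r.
split.
- split=> [f _|f g _ _ _|a f g _ _|].
  + exact: Lfun2_cst0.
  + exact: aeW.
  + by apply: aeW => x _; rewrite mulr0 addr0.
  + by exists 0 => f _; rewrite in0 mul0r.
- by move=> f g _ _; rewrite in0 L2_innerC in0.
- by move=> f _; rewrite in0.
Qed.

Lemma positive_operator_linear (a : R) P Q : 0 <= a ->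
  positive_operator mu P -> positive_operator mu Q ->
  positive_operator mu (fun f x => a * P f x + Q f x).
Proof.
move=> a0 [[P2 Pae Plin [C PC]] Psym Ppos] [[Q2 Qae Qlin [D QD]] Qsym Qpos].
split; first split.
- by move=> f f2; apply: Lfun2_linear; [exact: P2|exact: Q2].
- move=> f g f2 g2 fg; apply: filterS2 (Pae _ _ f2 g2 fg) (Qae _ _ f2 g2 fg).
  by move=> x /(_ I) -> /(_ I) ->.
- move=> b f g f2 g2; apply: filterS2 (Plin b _ _ f2 g2) (Qlin b _ _ f2 g2).
  by move=> x /(_ I) -> /(_ I) -> _; ring.
(* From |a P f + Q f|^2 <= 2 a^2 |P f|^2 + 2 |Q f|^2 in the L_2 norm, which is the nonnegativity of
   |- a P f + Q f|^2. *)
- exists (2 * a ^+ 2 * C + 2 * D) => f f2.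
  have Pf := P2 _ f2; have Qf := Q2 _ f2.
  have R2 := Lfun2_linear a Pf Qf.
  have S2 := Lfun2_linear (- a) Pf Qf.
  have := L2_inner_ge0 mu (fun x => - a * P f x + Q f x).
  rewrite !(L2_inner_linearl _ _ _ R2, L2_inner_linearl _ _ _ S2)//.
  rewrite !L2_inner_linearr// (L2_innerC _ (Q f) (P f)).
  have := PC _ f2; have := QD _ f2.
  move: (L2_inner _ _ _) (L2_inner _ (P f) (P f)) (L2_inner _ (Q f) (Q f))
    (L2_inner _ (P f) (Q f)).
  move=> N p q pq qN pN S.
  have : a ^+ 2 * p <= a ^+ 2 * (C * N) by rewrite ler_wpM2l// sqr_ge0.
  nra.
- move=> f g f2 g2.
  rewrite L2_inner_linearl ?L2_inner_linearr//; try by [exact: P2|exact: Q2].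
  by rewrite Psym// Qsym.
- move=> f f2; rewrite L2_inner_linearl//; try by [exact: P2|exact: Q2].
  by rewrite addr_ge0// ?mulr_ge0 ?Ppos ?Qpos.
Qed.

Lemma positive_operator_sum (a : R) (I : Type) (s : seq I)
    (P : I -> (T -> R) -> T -> R) : 0 <= a ->
  (forall i, positive_operator mu (P i)) ->
  positive_operator mu (fun f x => a * \sum_(i <- s) P i f x).
Proof.
move=> a0 Ppos; elim: s => [|i s IH].
  under eq_fun do under eq_fun do rewrite big_nil mulr0.
  exact: positive_operator0.
under eq_fun do under eq_fun do rewrite big_cons mulrDr.
exact: positive_operator_linear.
Qed.

(* An idempotent symmetric operator is positive since
   [<P f, f> = <P (P f), f> = <P f, P f>]. *)
Lemma positive_projection P : bounded_L2_operator mu P ->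
  (forall f g, f \in Lfun mu 2%:E -> g \in Lfun mu 2%:E ->
    (forall x, 0 <= f x) -> (forall x, 0 <= g x) ->
    L2_inner mu (P f) g = L2_inner mu f (P g)) ->
  (forall f, f \in Lfun mu 2%:E -> P (P f) = P f %[ae mu]) ->
  positive_operator mu P.
Proof.
move=> bP sym0 idP; have [P2 Pae Plin _] := bP.
(* Positive minus negative part, written in the shape to which [L2_op_linear] applies. *)
have decomp f : f = fun x => -1 * Num.max (- f x) 0 + Num.max (f x) 0.
  by apply/funext => x; rewrite !maxEle oppr_le0; case: ltgtP => /=; lra.
have N2 f : f \in Lfun mu 2%:E -> (fun x => - f x) \in Lfun mu 2%:E.
  move=> f2; have := Lfun2_linear (-1) f2 (Lfun2_cst0 mu).
  by under eq_fun do rewrite mulN1r addr0.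
have symlin a f f' g : f \in Lfun mu 2%:E -> f' \in Lfun mu 2%:E ->
    g \in Lfun mu 2%:E ->
    L2_inner mu (P f) g = L2_inner mu f (P g) ->
    L2_inner mu (P f') g = L2_inner mu f' (P g) ->
    L2_inner mu (P (fun x => a * f x + f' x)) g =
    L2_inner mu (fun x => a * f x + f' x) (P g).
  move=> f2 f'2 g2 fg f'g.
  have ff' := Lfun2_linear a f2 f'2.
  have Pf := P2 _ f2; have Pf' := P2 _ f'2.
  have mP := Lfun2_measurable (P2 _ ff').
  have mPP := Lfun2_measurable (Lfun2_linear a Pf Pf').
  have mg := Lfun2_measurable g2.
  rewrite (L2_inner_ael mP mPP mg (Plin a _ _ f2 f'2)).
  rewrite !L2_inner_linearl ?fg ?f'g//; exact: P2.
have max0_ge0 f (x : T) : 0 <= Num.max (f x) 0 by rewrite le_max lexx orbT.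
(* Symmetry passes to signed functions one argument at a time: first [f], then [g] with the roles
   exchanged. *)
have symP0 f g : f \in Lfun mu 2%:E -> g \in Lfun mu 2%:E ->
    (forall x, 0 <= g x) -> L2_inner mu (P f) g = L2_inner mu f (P g).
  move=> f2 g2 g0; have fN := Lfun2_max0 (N2 _ f2); have fP := Lfun2_max0 f2.
  rewrite (decomp f); apply: (symlin _ _ _ _ fN fP g2).
    by apply: (sym0) => // x; exact: (max0_ge0 (fun x => - f x)).
  by apply: (sym0) => // x; exact: max0_ge0.
have symP : self_adjoint mu P.
  move=> f g f2 g2; have gN := Lfun2_max0 (N2 _ g2); have gP := Lfun2_max0 g2.
  rewrite L2_innerC [RHS]L2_innerC; apply/esym; rewrite (decomp g).
  apply: (symlin _ _ _ _ gN gP f2); rewrite L2_innerC [RHS]L2_innerC.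
    by rewrite symP0// => x; exact: (max0_ge0 (fun x => - g x)).
  by rewrite symP0// => x; exact: max0_ge0.
split => // f f2; have Pf := P2 _ f2.
have mPf := Lfun2_measurable Pf; have mPPf := Lfun2_measurable (P2 _ Pf).
rewrite -(L2_inner_ael mPPf mPf (Lfun2_measurable f2) (idP _ f2)).
by rewrite symP// L2_inner_ge0.
Qed.

End positive_operators.

(** * From completed measures to Borel ones, and chord integrals *)

Section completion_integral.
Context d (T : measurableType d) (R : realType).
Variable mu : {sigma_finite_measure set T -> \bar R}.
Local Notation cT := (caratheodory_type (mu_ext mu)).
Local Notation cmu := (@completed_measure_extension _ T R mu).

Let cmu_complete : measure_is_complete cmu.
Proof. exact: measure_is_complete_caratheodory. Qed.

Lemma measurable_fun_ae_completed (f : cT -> R) (g : T -> R) :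
  measurable_fun setT g -> (\forall x \ae mu, f x = g x) -> measurable_fun setT f.
Proof.
move=> mg fg; apply/measurable_EFinP.
have mEg : measurable_fun setT (EFin \o g) by exact/measurable_EFinP.
have Efg : \forall x \ae cmu, (EFin \o f) x = (EFin \o g) (id x).
  have := ae_completed fg.
  by apply: filterS => x /= ->.
exact: (complete_ae_measurable (@measurable_id_completed _ _ _ mu)
  cmu_complete mEg Efg).
Qed.

Lemma ge0_integral_completed (f : T -> \bar R) :
  measurable_fun setT f -> (forall x, 0 <= f x)%E ->
  (\int[cmu]_x f x = \int[mu]_x f x)%E.
Proof.
move=> mf f0.
exact: (ge0_integral_measure_preserving (@measurable_id_completed _ _ _ mu)
  (@completed_measureE _ _ _ mu)).
Qed.

End completion_integral.

(** Extending [g] by zero outside [K] replaces the chord by the whole line. Along it [g] is only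
    known to agree almost everywhere with a Borel function, and completeness of the one-dimensional
    measure supplies measurability. *)
Lemma chord_integral_ae (R : realType) n (K : set 'rV[R]_n) (x th : 'rV[R]_n)
    (g : 'rV[R]_n -> R) (h : R -> R) :
  measurable_fun [set: measurableTypeR R] h ->
  (\forall s \ae @lebesgue_measure R, (g \_ K) (x + s *: th) = h s) ->
  chord_integral K x th g = \int[@lebesgue_measure R]_s h s.
Proof.
move=> mh gh; rewrite /chord_integral Rintegral_mkcond.
have mid : measurable_fun setT
    (id : caratheodory_type (mu_ext (@wlength R idfun)) -> measurableTypeR R).
  by move=> _ A mA; rewrite setTI; exact: sub_caratheodory.
have mE (A : set (measurableTypeR R)) : measurable A ->
  @completed_lebesgue_measure R (id @^-1` A) = lebesgue_measure A by [].
congr fine.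
apply: (complete_ae_integral mid mE completed_lebesgue_measure_is_complete).
  exact/measurable_EFinP.
have := ae_measure_preserving mid mE gh.
apply: (@filterS _ _ (ae_filter_ringOfSetsType completed_lebesgue_measure)) => s <-.
rewrite /= !patchE; congr (EFin (if _ then _ else _)).
apply/idP/idP => /set_mem h1; apply/mem_set; first by case: h1.
by split => //; exists s.
Qed.

(** * Line means on L_2(pi) for a Borel density *)

Section line_mean_L2.
Local Open Scope ereal_scope.
Context (R : realType) (n : nat) (th : 'rV[R]_n) (r : borel_rV R n -> R).
Hypothesis mr : measurable_fun setT r.
Hypothesis r_ge0 : forall x, (0 <= r x)%R.
Variable c : R.
Hypothesis c_gt0 : (0 < c)%R.
Variable pi : probability (lebesgue_space R n) R.
Local Notation mu := (lebesgue_borel_rV R n).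
Local Notation cmu := (@lebesgue_rV R n).
Hypothesis piE : forall A : set (lebesgue_space R n), measurable A ->
  pi A = \int[cmu]_(x in A) (c * r x)%:E.
Local Notation M := (line_mean th r).
Local Notation eM := (eline_mean th r).
Implicit Types (f g : borel_rV R n -> R) (h : borel_rV R n -> \bar R).

Let mcr : measurable_fun [set: lebesgue_space R n] (fun x => (c * r x)%R).
Proof. by apply: measurable_funM => //; exact: measurable_fun_completed. Qed.

Let cr_ge0 x : (0 <= c * r x)%R.
Proof. by rewrite mulr_ge0// ltW. Qed.

(** [pi] is absolutely continuous and gives no mass to the zero set of [r]. *)
Lemma ae_pi (P : lebesgue_space R n -> Prop) :
  (\forall x \ae mu, r x != 0%R -> P x) -> \forall x \ae pi, P x.
Proof.
move=> /ae_completed[N [mN N0 PN]].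
have piN : \forall x \ae pi, r x != 0%R -> P x.
  exists N; split => //; rewrite piE//.
  apply: null_set_integral => //.
  by apply/measurable_EFinP; exact: measurable_funTS.
have pi0 : \forall x \ae pi, r x != 0%R.
  have mZ : measurable (r @^-1` [set 0%R] : set (lebesgue_space R n)).
    by apply: measurable_completed; rewrite -[X in measurable X]setTI; exact: mr.
  exists (r @^-1` [set 0%R]); split => //.
    rewrite piE//; under eq_integral => x /set_mem rx0 do rewrite rx0 mulr0.
    exact: integral0.
  by move=> x /= /negP; rewrite negbK => /eqP.
by apply: (@filterS2 _ _ (ae_filter_ringOfSetsType pi)) pi0 piN => x rx; exact.
Qed.

(** On a [pi]-null set the density has integral 0, so it vanishes there almost everywhere. This is
    all that equality in L_2(pi) says about Lebesgue null sets. *)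
Lemma pi_ae (P : lebesgue_space R n -> Prop) :
  (\forall x \ae pi, P x) -> \forall x \ae mu, r x != 0%R -> P x.
Proof.
move=> [N [mN + PN]]; rewrite piE// integral_mkcond => /ge0_integral_eq0_ae.
case.
- apply/(measurable_restrictT _ mN)/measurable_EFinP; exact: measurable_funTS.
- by move=> x; apply: erestrict_ge0 => y _; rewrite lee_fin.
move=> A [mA A0 NA].
have /ae_completedP[B [mB B0 BN]] :
    \forall x \ae @completed_measure_extension _ _ R mu,
      ((fun x => (c * r x)%:E) \_ N) x = 0.
  by exists A.
exists B; split => // x /= rP; apply: contrapT => /BN; rewrite patchE.
case: (boolP (x \in N)) => [_ [] /eqP|].
  rewrite mulf_eq0 (gt_eqF c_gt0)/= => /eqP r0; apply: rP.
  by rewrite r0 eqxx.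
rewrite notin_setE => Nx _; apply: rP => _.
by apply: contrapT => nP; exact/Nx/PN.
Qed.

Lemma ge0_integral_pi h : measurable_fun setT h -> (forall x, 0 <= h x) ->
  \int[pi]_x h x = c%:E * \int[mu]_x (h x * (r x)%:E).
Proof.
move=> mh h0; have mEr : measurable_fun setT (EFin \o r) by exact/measurable_EFinP.
rewrite (ge0_integral_density mcr cr_ge0 piE (measurable_fun_completed mh) h0).
rewrite (@ge0_integral_completed _ _ _ mu (fun x => h x * (c * r x)%:E)).
- rewrite -ge0_integralZl ?lee_fin ?(ltW c_gt0)//.
  + by apply: eq_integral => x _; rewrite EFinM muleCA.
  + exact: emeasurable_funM.
  + by move=> x _; rewrite mule_ge0// lee_fin.
- apply: emeasurable_funM => //; apply/measurable_EFinP; exact: measurable_funM.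
- by move=> x; rewrite mule_ge0// lee_fin.
Qed.

(** Symmetry against the constant 1 moves the mean from [h] onto 1, where it is at most 1. *)
Lemma eline_mean_contraction h : measurable_fun setT h -> (forall x, 0 <= h x) ->
  \int[pi]_x eM h x <= \int[pi]_x h x.
Proof.
move=> mh h0; rewrite !ge0_integral_pi//; last 2 first.
- exact: measurable_eline_mean.
- by move=> x; exact: eline_mean_ge0.
rewrite lee_wpmul2l ?lee_fin ?(ltW c_gt0)//.
have := @eline_mean_sym _ _ th r mr r_ge0 h (cst 1) mh h0.
rewrite (_ : (fun x => _ * cst 1 x * _) = (fun x => eM h x * (r x)%:E)); last first.
  by apply/funext => x; rewrite mule1.
move=> -> //.
have mEr : measurable_fun setT (EFin \o r) by exact/measurable_EFinP.
have eM1_ge0 x : 0 <= eM (cst 1) x by exact: eline_mean_ge0.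
apply: ge0_le_integral => //.
- by move=> x _; apply: mule_ge0; rewrite ?lee_fin// mule_ge0.
- apply: emeasurable_funM => //; apply: emeasurable_funM => //.
  exact: measurable_eline_mean.
- exact: emeasurable_funM.
- move=> x _; rewrite lee_wpmul2r ?lee_fin//.
  by rewrite -[leRHS]mule1 lee_wpmul2l// eline_mean1_le1.
Qed.

Section line_mean_L2_fun.
Variable f : borel_rV R n -> R.
Hypothesis mf : measurable_fun setT f.
Hypothesis f2 : (f : lebesgue_space R n -> R) \in Lfun pi 2%:E.

(** A square-integrable function is integrable for a probability; by the contraction the mean of its
    absolute value is integrable too, hence finite almost everywhere. *)
Lemma eline_mean_abs_lty : \forall x \ae pi, eM (fun y => `|f y|%:E) x < +oo.
Proof.
have mEf : measurable_fun setT (fun y => `|f y|%:E).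
  by apply/measurable_EFinP; exact: measurableT_comp.
apply: integrable_ae_lty.
- by apply: measurable_fun_completed; exact: measurable_eline_mean.
- by move=> x; exact: eline_mean_ge0.
apply: le_lt_trans (eline_mean_contraction mEf _) _ => //.
have /Lfun1_integrable/integrableP[_] :=
  Lfun_subset12 (fin_num_measure pi _ measurableT) f2.
by [].
Qed.

(** Pointwise, the square of the mean of [f] is at most that of the mean of |f|, hence by Jensen at
    most the mean of f^2; the L_1 contraction is then applied to f^2. *)
Lemma line_mean_sqr_contraction :
  \int[pi]_x (M f x ^+ 2)%:E <= \int[pi]_x (f x ^+ 2)%:E.
Proof.
have mf2 : measurable_fun setT (fun y => (f y ^+ 2)%:E).
  by apply/measurable_EFinP; exact: measurable_funX.
apply: le_trans (eline_mean_contraction mf2 _); last first.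
  by move=> x; rewrite lee_fin sqr_ge0.
apply: ae_ge0_le_integral => //.
- by move=> x _; rewrite lee_fin sqr_ge0.
- apply/measurable_EFinP/measurable_funX/measurable_fun_completed.
  exact: measurable_line_mean.
- by move=> x _; apply: eline_mean_ge0 => // y; rewrite lee_fin sqr_ge0.
- apply: measurable_fun_completed; apply: measurable_eline_mean => // y.
  by rewrite lee_fin sqr_ge0.
apply: (@filterS _ _ (ae_filter_ringOfSetsType pi)) eline_mean_abs_lty => x xoo _.
have mnf : measurable_fun setT (fun y => `|f y|%R) by exact: measurableT_comp.
have ME := line_mean_ge0E mr r_ge0 mnf (fun y => normr_ge0 _) xoo.
have := line_mean_sqr_le mr r_ge0 mnf (fun y => normr_ge0 _) xoo.
under [X in eM X]eq_fun do rewrite real_normK ?num_real//.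
apply: le_trans; rewrite lee_fin -(real_normK (num_real (M f x))).
rewrite lerXn2r ?nnegrE//; last 2 first.
- by rewrite -lee_fin ME; apply: eline_mean_ge0 => // y; rewrite lee_fin.
- by rewrite -lee_fin ME; exact: abs_line_mean_le.
Qed.

Lemma Lfun2_line_mean : (M f : lebesgue_space R n -> R) \in Lfun pi 2%:E.
Proof.
apply: Lfun2_le f2 line_mean_sqr_contraction.
by apply: measurable_fun_completed; exact: measurable_line_mean.
Qed.

End line_mean_L2_fun.

(** Real and extended means agree almost everywhere, so both inner products are [fine] of [c] times
    the two sides of [eline_mean_sym]. *)
Lemma line_mean_L2_sym f g :
  measurable_fun setT f -> (f : lebesgue_space R n -> R) \in Lfun pi 2%:E ->
  measurable_fun setT g -> (g : lebesgue_space R n -> R) \in Lfun pi 2%:E ->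
  (forall x, 0 <= f x)%R -> (forall x, 0 <= g x)%R ->
  L2_inner pi (M f) g = L2_inner pi f (M g).
Proof.
have inner_e f1 g1 : measurable_fun setT f1 -> measurable_fun setT g1 ->
    (f1 : lebesgue_space R n -> R) \in Lfun pi 2%:E ->
    (forall x, 0 <= f1 x)%R -> (forall x, 0 <= g1 x)%R ->
    \int[pi]_x (M f1 x * g1 x)%:E =
    c%:E * \int[mu]_x (eM (EFin \o f1) x * (EFin \o g1) x * (r x)%:E).
  move=> mf1 mg1 f12 f10 g10; rewrite -ge0_integral_pi; last 2 first.
  - apply: emeasurable_funM; last exact/measurable_EFinP.
    by apply: measurable_eline_mean => //; exact/measurable_EFinP.
  - by move=> x; rewrite mule_ge0 ?lee_fin// eline_mean_ge0.
  apply: ae_eq_integral; first exact: measurableT.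
  - apply/measurable_EFinP.
    apply: measurable_funM; apply: measurable_fun_completed => //.
    exact: measurable_line_mean.
  - apply: measurable_fun_completed.
    apply: emeasurable_funM; last exact/measurable_EFinP.
    by apply: measurable_eline_mean => //; exact/measurable_EFinP.
  apply: (@filterS _ _ (ae_filter_ringOfSetsType pi))
    (eline_mean_abs_lty mf1 f12) => x xoo _.
  rewrite EFinM (line_mean_ge0E mr r_ge0)//.
  by move: xoo; under eq_fun do rewrite ger0_norm//.
move=> mf f2 mg g2 f0 g0; rewrite [RHS]L2_innerC /L2_inner /Rintegral.
congr fine; rewrite !inner_e//; congr (_ * _).
rewrite eline_mean_sym//; try by [exact/measurable_EFinP|move=> x; rewrite lee_fin].
by apply: eq_integral => x _; congr (_ * _); rewrite muleC.
Qed.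

End line_mean_L2.

(** The summand of [gibbs], for an arbitrary direction. *)
Definition chord_mean (R : realType) n (K : set 'rV[R]_n) (rho : 'rV[R]_n -> R)
    (th : 'rV[R]_n) (f : 'rV[R]_n -> R) (x : 'rV[R]_n) : R :=
  (chord_weight K rho x th)^-1 * chord_integral K x th (fun y => f y * rho y).

(** * Chord means of Lebesgue measurable data *)

Section chord_mean_positive.
Context (R : realType) (n : nat) (th : 'rV[R]_n) (r : borel_rV R n -> R).
Hypothesis mr : measurable_fun setT r.
Hypothesis r_ge0 : forall x, 0 <= r x.
Variable c : R.
Hypothesis c_gt0 : 0 < c.
Variable pi : probability (lebesgue_space R n) R.
Local Notation mu := (lebesgue_borel_rV R n).
Hypothesis piE : forall A : set (lebesgue_space R n), measurable A ->
  pi A = (\int[@lebesgue_rV R n]_(x in A) (c * r x)%:E)%E.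
Variables (K : set 'rV[R]_n) (rho : 'rV[R]_n -> R).
Hypothesis rhoE : \forall x \ae mu, (rho \_ K) x = r x.
Local Notation M := (line_mean th r).
Local Notation E := (chord_mean K rho th).
Local Notation filterS_mu := (@filterS _ _ (ae_filter_ringOfSetsType mu) _ _).
Local Notation filterS2_mu :=
  (@filterS2 _ _ (ae_filter_ringOfSetsType mu) _ _ _).
Local Notation filterS2_pi :=
  (@filterS2 _ _ (ae_filter_ringOfSetsType pi) _ _ _).
Local Notation filterS3_pi :=
  (@filterS3 _ _ (ae_filter_ringOfSetsType pi) _ _ _ _).
Implicit Types f g : 'rV[R]_n -> R.

(** Where [r] vanishes, so does [f * rho] on [K], up to a null set; agreement elsewhere therefore
    suffices. This covers both the choice of a Borel version and the choice of a representative
    modulo [pi]. *)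
Lemma chord_mean_ae f g : measurable_fun [set: borel_rV R n] g ->
  (\forall x \ae mu, r x != 0 -> f x = g x) ->
  \forall x \ae mu, E f x = M g x.
Proof.
move=> mg fg.
have frho : \forall x \ae mu, ((fun y => f y * rho y) \_ K) x = g x * r x.
  apply: filterS2_mu rhoE fg => x rhox fgx.
  have [rx0|/fgx <-] := eqVneq (r x) 0.
    rewrite rx0 mulr0; move: rhox; rewrite rx0 !patchE; case: ifPn => // _ ->.
    by rewrite mulr0.
  by rewrite -rhox !patchE; case: ifPn => // _; rewrite mulr0.
apply: filterS2_mu (ae_line th rhoE) (ae_line th frho) => x rhox frhox.
rewrite /chord_mean /line_mean /chord_weight.
have mgr : measurable_fun [set: borel_rV R n] (fun y => g y * r y).
  exact: measurable_funM.
rewrite (chord_integral_ae _ rhox).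
  rewrite (chord_integral_ae _ frhox)//.
  exact: measurableT_comp mgr (measurable_line2 th x).
exact: measurableT_comp mr (measurable_line2 th x).
Qed.

Let ae_mu_pi (P : 'rV[R]_n -> Prop) :
  (\forall x \ae mu, P x) -> \forall x \ae pi, P x.
Proof.
by move=> muP; apply: (ae_pi mr piE); apply: filterS_mu muP => x.
Qed.

Let measurable_chord_mean f g : measurable_fun [set: borel_rV R n] g ->
  (\forall x \ae mu, f x = g x) -> measurable_fun [set: lebesgue_space R n] (E f).
Proof.
move=> mg fg; apply: measurable_fun_ae_completed.
  exact: (measurable_line_mean th mr r_ge0 mg).
by apply: chord_mean_ae => //; apply: filterS_mu fg => x.
Qed.

Let borel_rep f : (f : lebesgue_space R n -> R) \in Lfun pi 2%:E ->
  exists g : borel_rV R n -> R, [/\ measurable_fun setT g,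
    (g : lebesgue_space R n -> R) \in Lfun pi 2%:E,
    \forall x \ae mu, f x = g x &
    (forall x, 0 <= f x) -> (forall x, 0 <= g x)].
Proof.
move=> f2; have mf := Lfun2_measurable f2.
have [g0 [mg0 fg0]] := completed_fun_ae mf.
have L2 g : measurable_fun [set: borel_rV R n] g ->
    (\forall x \ae mu, f x = g x) ->
    (g : lebesgue_space R n -> R) \in Lfun pi 2%:E.
  move=> mg fg; apply: Lfun2_ae f2 => //.
    exact: measurable_fun_completed.
  apply: ae_mu_pi; apply: filterS_mu fg => x ->; exact.
(* Symmetry is available for functions nonnegative everywhere; the absolute value repairs the sign
   on the exceptional set. *)
have [f0|f0] := pselect (forall x, 0 <= f x).
- have mg : measurable_fun setT (fun x => `|g0 x|) by exact: measurableT_comp.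
  have fg : \forall x \ae mu, f x = `|g0 x|.
    by apply: filterS_mu fg0 => x <-; rewrite ger0_norm.
  by exists (fun x => `|g0 x|); split => //; exact: L2.
- by exists g0; split => //; exact: L2.
Qed.

Let chord_mean_pi f g : measurable_fun [set: borel_rV R n] g ->
  (\forall x \ae mu, f x = g x) -> E f = M g %[ae pi].
Proof.
move=> mg fg; apply: ae_mu_pi.
have : \forall x \ae mu, E f x = M g x.
  by apply: chord_mean_ae => //; apply: filterS_mu fg => x.
by apply: filterS_mu => x ->.
Qed.

Let Lfun2_chord_mean f : (f : lebesgue_space R n -> R) \in Lfun pi 2%:E ->
  (E f : lebesgue_space R n -> R) \in Lfun pi 2%:E.
Proof.
move=> f2; have [g [mg g2 fg _]] := borel_rep f2.
apply: (Lfun2_ae _ _ (chord_mean_pi mg fg)).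
- exact: measurable_chord_mean fg.
- by apply: measurable_fun_completed; exact: measurable_line_mean.
- exact: (Lfun2_line_mean th mr r_ge0 c_gt0 piE).
Qed.

Let chord_mean_bounded : bounded_L2_operator pi E.
Proof.
split.
- exact: Lfun2_chord_mean.
- move=> f g f2 g2 fg; have [f' [mf' f'2 ff' _]] := borel_rep f2.
  apply: ae_mu_pi.
  have Ef : \forall x \ae mu, E f x = M f' x.
    by apply: chord_mean_ae => //; apply: filterS_mu ff' => x.
  (* Equality modulo [pi] gives [g = f'] only where [r] is nonzero, up to a null set, which is what
     [chord_mean_ae] asks for. *)
  have Eg : \forall x \ae mu, E g x = M f' x.
    apply: chord_mean_ae => //.
    apply: filterS2_mu (pi_ae mr r_ge0 c_gt0 piE fg) ff' => x fgx ff'x rx.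
    by rewrite -ff'x fgx.
  by apply: filterS2_mu Ef Eg => x -> ->.
- move=> a f g f2 g2.
  have [f' [mf' f'2 ff' _]] := borel_rep f2.
  have [g' [mg' g'2 gg' _]] := borel_rep g2.
  have mfg : measurable_fun [set: borel_rV R n] (fun x => a * f' x + g' x).
    by apply: measurable_funD => //; exact: measurable_funM.
  have fg : \forall x \ae mu, a * f x + g x = a * f' x + g' x.
    by apply: filterS2_mu ff' gg' => x -> ->.
  have Efg := chord_mean_pi mfg fg.
  have Ef := chord_mean_pi mf' ff'; have Eg := chord_mean_pi mg' gg'.
  have Lf := eline_mean_abs_lty th mr r_ge0 c_gt0 piE mf' f'2.
  have Lg := eline_mean_abs_lty th mr r_ge0 c_gt0 piE mg' g'2.
  apply: filterS2_pi (filterS2_pi (fun x a b => conj a b) Lf Lg)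
    (filterS3_pi (fun x a b c => And3 a b c) Efg Ef Eg) => x [Lfx Lgx].
  move=> [/(_ I) -> /(_ I) -> /(_ I) ->] _.
  exact: line_mean_linear.
(* The constant is 1 because the line mean is a contraction of L_2. *)
- exists 1 => f f2; rewrite mul1r.
  have [g [mg g2 fg _]] := borel_rep f2.
  have Ef2 := Lfun2_chord_mean f2; have mf := Lfun2_measurable f2.
  have mg' := Lfun2_measurable g2; have mEf := Lfun2_measurable Ef2.
  have mMg : measurable_fun [set: lebesgue_space R n] (M g).
    by apply: measurable_fun_completed; exact: measurable_line_mean.
  have sqrE (h : lebesgue_space R n -> R) : h \in Lfun pi 2%:E ->
      (L2_inner pi h h)%:E = (\int[pi]_x (h x ^+ 2)%:E)%E.
    move=> h2; rewrite /L2_inner /Rintegral fineK//.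
    exact: (integrable_fin_num measurableT (Lfun2M_integrable h2 h2)).
  rewrite -lee_fin !sqrE//.
  rewrite (ae_sqr_integral mEf mMg (chord_mean_pi mg fg)).
  have fg' : f = g %[ae pi] by apply: ae_mu_pi; apply: filterS_mu fg => x ->.
  rewrite (ae_sqr_integral mf mg' fg').
  exact: (line_mean_sqr_contraction th mr r_ge0 c_gt0 piE).
Qed.

Lemma positive_chord_mean : positive_operator pi E.
Proof.
apply: (positive_projection chord_mean_bounded).
- move=> f g f2 g2 f0 g0.
  have [f' [mf' f'2 ff' f'0]] := borel_rep f2.
  have [g' [mg' g'2 gg' g'0]] := borel_rep g2.
  have ff'pi : f = f' %[ae pi] by apply: ae_mu_pi; apply: filterS_mu ff' => x ->.
  have gg'pi : g = g' %[ae pi] by apply: ae_mu_pi; apply: filterS_mu gg' => x ->.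
  have m2 := @Lfun2_measurable _ _ _ pi.
  have mM h : measurable_fun [set: borel_rV R n] h ->
      measurable_fun [set: lebesgue_space R n] (M h).
    by move=> mh; apply: measurable_fun_completed; exact: measurable_line_mean.
  have mE h := m2 _ (Lfun2_chord_mean h).
  have inner_E (h k h' k' : lebesgue_space R n -> R) :
      measurable_fun setT h -> measurable_fun setT h' ->
      measurable_fun setT k -> measurable_fun setT k' ->
      h = h' %[ae pi] -> k = k' %[ae pi] -> L2_inner pi h k = L2_inner pi h' k'.
    move=> mh mh' mk mk' hh' kk'.
    rewrite (L2_inner_ael mh mh' mk hh') L2_innerC.
    by rewrite (L2_inner_ael mk mk' mh' kk') L2_innerC.
  rewrite (inner_E _ _ _ _ (mE _ f2) (mM _ mf')
    (m2 _ g2) (m2 _ g'2) (chord_mean_pi mf' ff') gg'pi).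
  rewrite (inner_E _ _ _ _ (m2 _ f2) (m2 _ f'2)
    (mE _ g2) (mM _ mg') ff'pi (chord_mean_pi mg' gg')).
  by apply: (line_mean_L2_sym th mr r_ge0 c_gt0 piE) => //; [exact: f'0|exact: g'0].
- move=> f f2; have [g [mg g2 fg _]] := borel_rep f2.
  have Ef : \forall x \ae mu, E f x = M g x.
    by apply: chord_mean_ae => //; apply: filterS_mu fg => x.
  have mMg := measurable_line_mean th mr r_ge0 mg.
  (* [M g] is itself a Borel version of [E f], so the comparison applies a second time. *)
  have EEf : \forall x \ae mu, E (E f) x = M (M g) x.
    by apply: chord_mean_ae => //; apply: filterS_mu Ef => x.
  apply: ae_mu_pi; apply: filterS2_mu Ef EEf => x -> -> _.
  by rewrite line_mean_idem.
Qed.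

End chord_mean_positive.

(** * Positivity of the random scan Gibbs sampler *)

Theorem mainTheorem4 (R : realType) (d : nat) (d_gt0 : (0 < d)%N)
    (K : set (lebesgue_space R d)) (rho : lebesgue_space R d -> R)
    (pi : probability (lebesgue_space R d) R)
    (mK : measurable K)
    (K_interior : interior (K : set 'rV[R]_d) !=set0)
    (rho_ge0 : forall x, K x -> 0 <= rho x)
    (rho_int : (@lebesgue_rV R d).-integrable K (EFin \o rho))
    (rho_gt0 : 0 < \int[@lebesgue_rV R d]_(x in K) rho x)
    (piE : forall A : set (lebesgue_space R d), measurable A ->
      pi A = (\int[@lebesgue_rV R d]_(x in A `&` K) rho x /
              \int[@lebesgue_rV R d]_(x in K) rho x)%:E) :
  positive_operator pi (gibbs K rho).
Proof.
have mrho : measurable_fun setT (rho \_ K).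
  apply/(measurable_restrictT _ mK)/measurable_EFinP.
  exact: measurable_int rho_int.
have rhoK_ge0 x : 0 <= (rho \_ K) x.
  by rewrite patchE; case: ifPn => // /set_mem; exact: rho_ge0.
have [g [mg rhog]] := completed_fun_ae mrho.
(* The absolute value makes the Borel density nonnegative everywhere and changes it only on a null
   set. *)
pose r x := `|g x|.
have mr : measurable_fun setT r by exact: measurableT_comp.
have r_ge0 x : 0 <= r x by exact: normr_ge0.
have rhor : \forall x \ae lebesgue_borel_rV R d, (rho \_ K) x = r x.
  apply: (@filterS _ _
    (ae_filter_ringOfSetsType (lebesgue_borel_rV R d))) rhog => x.
  by rewrite /r => <-; rewrite ger0_norm.
pose Z := \int[@lebesgue_rV R d]_(x in K) rho x.
(* The restriction to [K] moves from the domain of integration into the density. *)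
have piE' (A : set (lebesgue_space R d)) : measurable A ->
    pi A = (\int[@lebesgue_rV R d]_(x in A) (Z^-1 * r x)%:E)%E.
  move=> mA; rewrite piE// -/Z mulrC EFinM.
  have mEr : measurable_fun A (EFin \o (r : lebesgue_space R d -> R)).
    apply/measurable_EFinP; apply: measurable_funTS.
    exact: measurable_fun_completed.
  have AKfin : (\int[@lebesgue_rV R d]_(x in A `&` K) (rho x)%:E)%E \is a fin_num.
    apply: integrable_fin_num; first exact: measurableI.
    by apply: integrableS rho_int => //; exact: measurableI.
  rewrite /Rintegral fineK// integral_mkcondr.
  under [RHS]eq_integral do rewrite EFinM.
  rewrite ge0_integralZl//; last 2 first.
  - by move=> x _; rewrite lee_fin.
  - by rewrite lee_fin invr_ge0 ltW.
  congr (_ * _)%E; apply: ae_eq_integral => //.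
  - apply: measurable_funTS; apply/(measurable_restrictT _ mK).
    exact: measurable_int rho_int.
  - have := ae_completed rhor.
    apply: (@filterS _ _ (ae_filter_ringOfSetsType (@lebesgue_rV R d))) => x <- _.
    by rewrite !patchE; case: (x \in K).
have Zgt0 : 0 < Z^-1 by rewrite invr_gt0.
apply: (@positive_operator_sum _ _ _ pi _ 'I_d _
  (fun j => chord_mean K rho (std_basis R j))).
  by rewrite invr_ge0.
by move=> j; exact: (positive_chord_mean _ mr r_ge0 Zgt0 piE' rhor).
Qed.
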